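(* Let $f\colon\mathbb{R}^n\to\mathcal{G}_{2n}$ be continuous and integrable. Suppose that the inverse Clifford-Fourier transform $$(\mathcal{F}_o^{-1} f)(x)=\int_{\mathbb{R}^n}e^{I(x,t)}f(t)\,dm(t)$$ is integrable on $\mathbb{R}^n$, and that for every $\underline{y}=y+y'\in\mathbb{R}^{2n}$ the functions $x\mapsto e^{(x,y')}(\mathcal{F}_o^{-1} f)(x)$ and $x\mapsto x_i e^{(x,y')}(\mathcal{F}_o^{-1} f)(x)$, $i=1,\dots,n$, are integrable on $\mathbb{R}^n$. Then $$\underline{y}\mapsto(\mathbf{F}_1(\mathcal{F}_o^{-1} f))(\underline{y})$$ is a monogenic extension of $f$ to all of $\mathbb{R}^{2n}$; that is, it is monogenic in $\mathbb{R}^{2n}$ and its restriction to $\mathbb{R}^n\subseteq\mathbb{R}^{2n}$ equals $f$.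
   Context: $\mathcal{G}_{2n}$ is the real Clifford algebra generated by an orthonormal basis $e_1,\dots,e_n,e'_1,\dots,e'_n$ of $\mathbb{R}^{2n}$, with $v^2=v\cdot v$ for all vectors $v$ (so basis vectors square to $1$ and distinct basis vectors anticommute). $\mathbb{R}^n$ is identified with the span of $e_1,\dots,e_n$ in $\mathbb{R}^{2n}$. The norm is $|A|^2=\sum_I\alpha_I^2$ for $A=\sum_I\alpha_I e_I$ in the standard basis of ordered products of basis vectors. Put $B_i=e_ie'_i$; then $B_i^2=-1$ and $B_iB_j=B_jB_i$. The measure is $dm(x)=(2\pi)^{-n/2}dx$ on $\mathbb{R}^n$, with $dx$ Lebesgue measure. For $x,y\in\mathbb{R}^n$, $I(x,y)=\sum_{i=1}^n B_ix_iy_i$. For $\underline{y}\in\mathbb{R}^{2n}$ write $\underline{y}=y+y'$ with $y=\sum_i y_ie_i$ and $y'=\sum_i y'_ie'_i$, let $(x,y')=\sum_i x_iy'_i$, and set $I(x,\underline{y})=I(x,y)-(x,y')$. For $g\colon\mathbb{R}^n\to\mathcal{G}_{2n}$, $$(\mathbf{F}_1 g)(\underline{y})=\int_{\mathbb{R}^n}e^{-I(x,\underline{y})}g(x)\,dm(x)$$ whenever the integral exists. A $C^1$ function $g$ with values in $\mathcal{G}_{2n}$ is monogenic in a domain $M\subseteq\mathbb{R}^{2n}$ if $\partial g=\sum_{i=1}^n\left(e_i\frac{\partial g}{\partial y_i}+e'_i\frac{\partial g}{\partial y'_i}\right)=0$ on $M$. *)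

(* Defs.v *)
From HB Require Import structures.
From mathcomp Require Import all_boot all_order all_algebra.
From mathcomp Require Import ring.
From mathcomp Require Import all_classical all_reals all_analysis.

Set Implicit Arguments.
Unset Strict Implicit.
Unset Printing Implicit Defensive.

Import Order.TTheory GRing.Theory Num.Theory.
Import numFieldNormedType.Exports.

Local Open Scope classical_set_scope.
Local Open Scope ring_scope.

(* The real Clifford algebra on m generators, each of square 1.  An element   *)
(* \sum_I a_I e_I is the family of its coordinates a_I in the standard basis  *)
(* e_I = e_i1 * ... * e_ik, where I = {i1 < ... < ik} is a subset of 'I_m.    *)
Definition clifford (R : realType) (m : nat) : Type :=
  {ffun {set 'I_m} -> R}.

Section CliffordAlgebra.
Variables (R : realType) (m : nat).
Local Notation cl := (clifford R m).
Implicit Types (I J K : {set 'I_m}) (A B C : cl).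

HB.instance Definition _ := GRing.Lmodule.copy cl {ffun {set 'I_m} -> R}.

Definition coef A I : R := (A : {ffun {set 'I_m} -> R}) I.

Definition cmk (a : {set 'I_m} -> R) : cl := [ffun I => a I].

Lemma coef_mk a I : coef (cmk a) I = a I.
Proof. by rewrite /coef ffunE. Qed.

Lemma cliffordP A B : coef A =1 coef B -> A = B.
Proof. by move=> AB; apply/ffunP => I; exact: AB. Qed.

Lemma coefD A B I : coef (A + B) I = coef A I + coef B I.
Proof. by rewrite /coef ffunE. Qed.

Lemma coefZ (a : R) A I : coef (a *: A) I = a * coef A I.
Proof. by rewrite /coef ffunE. Qed.

Lemma coef0 I : coef 0 I = 0.
Proof. by rewrite /coef ffunE. Qed.

Lemma coef_sum (T : Type) (r : seq T) (P : pred T) (F : T -> cl) I :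
  coef (\sum_(i <- r | P i) F i) I = \sum_(i <- r | P i) coef (F i) I.
Proof.
by apply: (big_morph (coef^~ I)) => [x y|]; rewrite ?coefD ?coef0.
Qed.

Definition symdiff I J : {set 'I_m} := [set i | (i \in I) (+) (i \in J)]%SET.

Lemma symdiffA : associative symdiff.
Proof. by move=> I J K; apply/setP => i; rewrite !inE addbA. Qed.

Lemma symdiffC : commutative symdiff.
Proof. by move=> I J; apply/setP => i; rewrite !inE addbC. Qed.

Lemma symdiffK I : involutive (symdiff I).
Proof. by move=> J; apply/setP => i; rewrite !inE addbA addbb. Qed.

Lemma symdiff0 I : symdiff I finset.set0 = I.
Proof. by apply/setP => i; rewrite !inE addbF. Qed.

Lemma symdiffI I : symdiff I I = finset.set0.
Proof. by apply/setP => i; rewrite !inE addbb. Qed.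

(* e_I * e_J = esign I J * e_(I + J), with I + J the symmetric difference:    *)
(* sorting the product e_I * e_J costs one anticommutation for each pair      *)
(* i \in I, j \in J with j < i, and repeated generators then square to 1.     *)
Definition esign I J : R := \prod_(i in I) \prod_(j in J | (j < i)%N) (-1).

Lemma prod_symdiff (c : 'I_m -> R) I J : (forall i, c i * c i = 1) ->
  \prod_(i in symdiff I J) c i = \prod_(i in I) c i * \prod_(i in J) c i.
Proof.
move=> c1; rewrite !(big_mkcond (fun i => i \in _)) /= -big_split /=.
apply: eq_bigr => i _; rewrite inE.
by case: (i \in I); case: (i \in J); rewrite /= ?mulr1 ?mul1r ?c1.
Qed.

Lemma esignDl I J K : esign (symdiff I J) K = esign I K * esign J K.
Proof.
rewrite /esign prod_symdiff// => i; rewrite -big_split /=.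
by apply: big1 => j _; rewrite mulrNN mulr1.
Qed.

Lemma esignDr I J K : esign I (symdiff J K) = esign I J * esign I K.
Proof.
rewrite /esign -big_split /=; apply: eq_bigr => i _.
rewrite !big_mkcondr /= prod_symdiff// => j.
by case: ifP; rewrite ?mulrNN mulr1.
Qed.

Lemma esign_sqr I J : esign I J * esign I J = 1.
Proof.
rewrite /esign -big_split /=; apply: big1 => i _.
by rewrite -big_split /=; apply: big1 => j _; rewrite mulrNN mulr1.
Qed.

Lemma esign0l J : esign finset.set0 J = 1.
Proof. by rewrite /esign big_set0. Qed.

Lemma esign0r I : esign I finset.set0 = 1.
Proof. by rewrite /esign big1 // => i _; apply: big1 => j; rewrite inE. Qed.

Definition cone : cl := cmk (fun I => (I == finset.set0)%:R).

Definition cmul A B : cl := cmk (fun K =>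
  \sum_(I : {set 'I_m}) \sum_(J : {set 'I_m} | symdiff I J == K)
    esign I J * coef A I * coef B J).

Lemma coef_mul A B K : coef (cmul A B) K =
  \sum_(I : {set 'I_m}) esign I (symdiff I K) * coef A I * coef B (symdiff I K).
Proof.
rewrite coef_mk; apply: eq_bigr => I _.
rewrite (big_pred1 (symdiff I K)) // => J /=.
by apply/eqP/eqP => [<-|->]; rewrite symdiffK.
Qed.

Fact esign_cocycle I J K :
  esign (symdiff I J) (symdiff J K) * esign I (symdiff I K) =
  esign I (symdiff I J) * esign J (symdiff J K).
Proof.
by rewrite !esignDl !esignDr -[RHS]mulr1 -(esign_sqr I K); ring.
Qed.

Fact cmulA : associative cmul.
Proof.
move=> A B C; apply: cliffordP => K; rewrite !coef_mul.
under eq_bigr do rewrite coef_mul mulr_sumr.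
under [RHS]eq_bigr do rewrite coef_mul mulr_sumr mulr_suml.
rewrite [RHS]exchange_big /=; apply: eq_bigr => I _.
rewrite (reindex_inj (inv_inj (symdiffK I))) /=; apply: eq_bigr => J _.
have -> : symdiff (symdiff I J) (symdiff I K) = symdiff J K.
  by rewrite (symdiffC I J) -symdiffA symdiffK.
transitivity (esign (symdiff I J) (symdiff J K) * esign I (symdiff I K) *
    (coef A I * coef B (symdiff I J) * coef C (symdiff J K))); first ring.
by rewrite esign_cocycle; ring.
Qed.

Fact cmul1l : left_id cone cmul.
Proof.
move=> A; apply: cliffordP => K; rewrite coef_mul (bigD1 finset.set0) //=.
rewrite big1 ?addr0 => [|I /negPf I0]; last by rewrite coef_mk I0 mulr0 mul0r.
by rewrite coef_mk eqxx esign0l symdiffC symdiff0 !mul1r.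
Qed.

Fact cmul1r : right_id cone cmul.
Proof.
move=> A; apply: cliffordP => K; rewrite coef_mul (bigD1 K) //=.
rewrite big1 ?addr0 => [|I /negPf IK].
  by rewrite coef_mk -[X in symdiff K X]symdiff0 symdiffK eqxx esign0r mulr1 mul1r.
rewrite coef_mk (_ : _ == _ = false) ?mulr0 //.
by apply/eqP => IK0; move: IK; rewrite -(symdiffK I K) IK0 symdiff0 eqxx.
Qed.

Fact cmulDl : left_distributive cmul +%R.
Proof.
move=> A B C; apply: cliffordP => K; rewrite coefD !coef_mul -big_split /=.
by apply: eq_bigr => I _; rewrite coefD; ring.
Qed.

Fact cmulDr : right_distributive cmul +%R.
Proof.
move=> A B C; apply: cliffordP => K; rewrite coefD !coef_mul -big_split /=.
by apply: eq_bigr => I _; rewrite coefD; ring.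
Qed.

Fact cone_neq0 : cone != 0.
Proof.
apply/eqP => /(congr1 (coef^~ finset.set0)); rewrite coef_mk coef0 eqxx => /eqP.
by rewrite oner_eq0.
Qed.

HB.instance Definition _ := GRing.Zmodule_isNzRing.Build cl
  cmulA cmul1l cmul1r cmulDl cmulDr cone_neq0.

Fact cscaleAl (a : R) A B : a *: (A * B) = (a *: A) * B.
Proof.
apply: cliffordP => K; rewrite coefZ !coef_mul mulr_sumr.
by apply: eq_bigr => I _; rewrite coefZ; ring.
Qed.

Fact cscaleAr (a : R) A B : a *: (A * B) = A * (a *: B).
Proof.
apply: cliffordP => K; rewrite coefZ !coef_mul mulr_sumr.
by apply: eq_bigr => I _; rewrite coefZ; ring.
Qed.

HB.instance Definition _ := GRing.Lmodule_isLalgebra.Build R cl cscaleAl.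
HB.instance Definition _ := GRing.Lalgebra_isAlgebra.Build R cl cscaleAr.

Definition cnorm A : R := Num.sqrt (\sum_(I : {set 'I_m}) coef A I ^+ 2).

Let cdot A B := \sum_(I : {set 'I_m}) coef A I * coef B I.

Let cnormE A : cnorm A = Num.sqrt (cdot A A).
Proof. by congr Num.sqrt; apply: eq_bigr => I _; rewrite expr2. Qed.

Let cdot_ge0 A : 0 <= cdot A A.
Proof. by apply: sumr_ge0 => I _; rewrite -expr2 sqr_ge0. Qed.

Let cauchy_schwarz A B : cdot A B ^+ 2 <= cdot A A * cdot B B.
Proof.
have : 0 <= \sum_I \sum_J (coef A I * coef B J - coef A J * coef B I) ^+ 2.
  by apply: sumr_ge0 => I _; apply: sumr_ge0 => J _; exact: sqr_ge0.
suff -> : \sum_I \sum_J (coef A I * coef B J - coef A J * coef B I) ^+ 2 =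
    2 * (cdot A A * cdot B B - cdot A B ^+ 2).
  by rewrite pmulr_rge0 // subr_ge0.
transitivity (\sum_I \sum_J ((coef A I * coef A I) * (coef B J * coef B J) +
    (coef B I * coef B I) * (coef A J * coef A J)
    - 2 * ((coef A I * coef B I) * (coef A J * coef B J)))).
  by apply: eq_bigr => I _; apply: eq_bigr => J _; ring.
under eq_bigr do rewrite sumrB big_split /= -!mulr_sumr.
rewrite sumrB big_split /= -!mulr_suml -mulr_sumr -mulr_suml -/(cdot A A).
by rewrite -/(cdot B B) -/(cdot A B); ring.
Qed.

Fact cnormD A B : cnorm (A + B) <= cnorm A + cnorm B.
Proof.
rewrite !cnormE -[leRHS]ger0_norm ?addr_ge0 ?sqrtr_ge0 // -sqrtr_sqr.
rewrite ler_sqrt ?sqr_ge0 // sqrrD !sqr_sqrtr ?cdot_ge0 //.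
have -> : cdot (A + B) (A + B) = cdot A A + cdot A B *+ 2 + cdot B B.
  rewrite mulr2n /cdot -!big_split /=.
  by apply: eq_bigr => I _; rewrite !coefD; ring.
rewrite lerD2r lerD2l lerMn2r /= -sqrtrM ?cdot_ge0 //.
apply: le_trans (ler_norm _) _; rewrite -sqrtr_sqr ler_sqrt.
  exact: cauchy_schwarz.
by rewrite mulr_ge0 ?cdot_ge0.
Qed.

Fact cnormZ (a : R) A : cnorm (a *: A) = `|a| * cnorm A.
Proof.
rewrite /cnorm -sqrtr_sqr -sqrtrM ?sqr_ge0 // mulr_sumr; congr Num.sqrt.
by apply: eq_bigr => I _; rewrite coefZ exprMn.
Qed.

Fact cnorm0_eq0 A : cnorm A = 0 -> A = 0.
Proof.
move=> /eqP; rewrite sqrtr_eq0 => A0; apply: cliffordP => I; rewrite coef0.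
apply/eqP; rewrite -sqrf_eq0 eq_le sqr_ge0 andbT; apply: le_trans A0.
by rewrite (bigD1 I) //= lerDl sumr_ge0 // => J _; exact: sqr_ge0.
Qed.

HB.instance Definition _ :=
  Lmodule_isNormed.Build R cl cnormD cnormZ cnorm0_eq0.

Lemma clifford_normE A :
  `|A| = Num.sqrt (\sum_(I : {set 'I_m}) coef A I ^+ 2).
Proof. by []. Qed.

Definition ebasis I : cl := cmk (fun J => (J == I)%:R).

Definition egen (i : 'I_m) : cl := ebasis [set i]%SET.

Lemma coef_ebasis I J : coef (ebasis I) J = (J == I)%:R.
Proof. exact: coef_mk. Qed.

Lemma clifford_sum A : A = \sum_(I : {set 'I_m}) coef A I *: ebasis I.
Proof.
apply: cliffordP => J; rewrite coef_sum (bigD1 J) //= big1 => [|I /negPf IJ].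
  by rewrite coefZ coef_ebasis eqxx mulr1 addr0.
by rewrite coefZ coef_ebasis eq_sym IJ mulr0.
Qed.

Lemma ebasis0 : ebasis finset.set0 = 1.
Proof. by []. Qed.

Lemma ebasisM I J : ebasis I * ebasis J = esign I J *: ebasis (symdiff I J).
Proof.
apply: cliffordP => K; rewrite coef_mul (bigD1 I) //= big1 => [|L /negPf LI].
  rewrite coefZ !coef_ebasis eqxx mulr1 addr0.
  have -> : (symdiff I K == J) = (K == symdiff I J).
    by apply/eqP/eqP => [<-|->]; rewrite symdiffK.
  by case: eqP => [->|_]; rewrite ?symdiffK // !mulr0.
by rewrite coef_ebasis LI mulr0 mul0r.
Qed.

Lemma egen_sqr i : egen i * egen i = 1.
Proof.
rewrite ebasisM /esign big_set1 big1 => [|j].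
  by rewrite scale1r symdiffI.
by rewrite inE => /andP[/eqP ->]; rewrite ltnn.
Qed.

Lemma egen_anticomm i j : i != j -> egen i * egen j = - (egen j * egen i).
Proof.
move=> ij; rewrite !ebasisM -scaleNr symdiffC; congr (_ *: _).
have E k l : esign [set k]%SET [set l]%SET = if (l < k)%N then -1 else 1.
  by rewrite /esign big_set1 big_mkcondr big_set1.
rewrite !E; case: ltngtP ij => // [_ _|/val_inj ->]; first by rewrite opprK.
by rewrite eqxx.
Qed.

Lemma ebasis_prod I : ebasis I = \prod_(i in I) egen i.
Proof.
suff H (s : seq 'I_m) : sorted ltn (map val s) ->
    \prod_(i <- s) egen i = ebasis [set i in s]%SET.
  rewrite -big_filter H.
    by congr ebasis; apply/setP => i; rewrite !inE mem_filter mem_index_enum andbT.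
  rewrite sorted_map; apply: sorted_filter.
    by move=> x y z; exact: ltn_trans.
  rewrite -sorted_map -[index_enum _]enumT val_enum_ord; exact: iota_ltn_sorted.
elim: s => [_|i s IH].
  by rewrite big_nil -ebasis0; congr ebasis; apply/setP => i; rewrite !inE.
rewrite /= (path_sortedE ltn_trans) => /andP[/allP lts /IH].
rewrite big_cons => ->; rewrite ebasisM /esign big_set1 big1 ?scale1r => [|j].
  congr ebasis; apply/setP => j; rewrite !inE; case: eqP => //= ->.
  by apply/negP => /(map_f val)/lts /=; rewrite ltnn.
rewrite inE => /andP[/(map_f val)/lts /=] ij ji.
by have := ltn_trans ij ji; rewrite ltnn.
Qed.

End CliffordAlgebra.

(* The series of the exponential, in the normed algebra clifford R m.         *)
Definition cexp (R : realType) (m : nat) (A : clifford R m) : clifford R m :=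
  limn (series (fun k : nat => (k`!%:R : R)^-1 *: A ^+ k)).

Section LebesgueMeasure.
Variable R : realType.
Local Open Scope ereal_scope.
Local Notation borelR := (measurableTypeR R).
Local Notation point n := (n.-tuple borelR).

Section Cons.
Variables (n : nat) (mu : {sigma_finite_measure set (point n) -> \bar R}).

Definition tcons (p : borelR * point n) : point n.+1 := [tuple of p.1 :: p.2].

Lemma measurable_tcons : measurable_fun setT tcons.
Proof. by apply: measurable_cons. Qed.

(* Product of the Lebesgue measure on R with mu, carried to tuples. *)
Definition lebesgue_cons : set (point n.+1) -> \bar R :=
  pushforward ((@lebesgue_measure R) \x mu) tcons.

Let lebesgue_cons0 : lebesgue_cons set0 = 0.
Proof. by rewrite /lebesgue_cons /pushforward preimage_set0 measure0. Qed.

Let measurable_preim A : measurable A -> measurable (tcons @^-1` A).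
Proof. by move=> mA; rewrite -[X in measurable X]setTI; exact: measurable_tcons. Qed.

Let lebesgue_cons_ge0 A : 0 <= lebesgue_cons A.
Proof. by rewrite /lebesgue_cons /pushforward; exact: measure_ge0. Qed.

Let lebesgue_cons_sigma_additive : semi_sigma_additive lebesgue_cons.
Proof.
move=> F mF tF mUF; rewrite /lebesgue_cons /pushforward preimage_bigcup.
apply: measure_semi_sigma_additive.
- by move=> k; exact: measurable_preim.
- apply/trivIsetP => /= i j _ _ ij; rewrite -preimage_setI.
  by move/trivIsetP : tF => /(_ _ _ _ _ ij) ->//; rewrite preimage_set0.
- by rewrite -preimage_bigcup; exact: measurable_preim.
Qed.

HB.instance Definition _ := isMeasure.Build _ _ _ lebesgue_cons
  lebesgue_cons0 lebesgue_cons_ge0 lebesgue_cons_sigma_additive.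

Let lebesgue_cons_sigma_finite : sigma_finite setT lebesgue_cons.
Proof.
have /sigma_finiteP[F [FT ndF Foo]] := sigma_finiteT (@lebesgue_measure R).
have /sigma_finiteP[G [GT ndG Goo]] := sigma_finiteT mu.
pose uncons (t : point n.+1) : borelR * point n :=
  (thead t, [tuple of behead t]).
have tconsK : cancel tcons uncons.
  by move=> [a t]; congr pair; apply: val_inj.
have muncons : measurable_fun setT uncons.
  apply: measurable_fun_pair.
  - exact: measurable_tnth.
  - exact: measurable_behead.
exists (fun k => uncons @^-1` (F k `*` G k)).
  apply/seteqP; split => // t _.
  have [k _ Fk] : (\bigcup_k F k) (thead t) by rewrite -FT.
  have [l _ Gl] : (\bigcup_k G k) [tuple of behead t] by rewrite -GT.
  exists (maxn k l) => //; split => /=.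
  - by move: Fk; exact/subsetPset/ndF/leq_maxl.
  - by move: Gl; exact/subsetPset/ndG/leq_maxr.
move=> k; have [mF Fk] := Foo k; have [mG Gk] := Goo k; split.
  by rewrite -[X in measurable X]setTI; apply: muncons => //; exact: measurableX.
rewrite /lebesgue_cons /pushforward -comp_preimage.
rewrite (_ : uncons \o tcons = id); last by apply/funext => p; exact: tconsK.
by rewrite preimage_id product_measure1E// lte_mul_pinfty// ge0_fin_numE.
Qed.

HB.instance Definition _ := Measure_isSigmaFinite.Build _ _ _ lebesgue_cons
  lebesgue_cons_sigma_finite.

End Cons.

Fixpoint lebesgueRn (n : nat) : {sigma_finite_measure set (point n) -> \bar R} :=
  match n with
  | 0 => \d_ [tuple]
  | n'.+1 => lebesgue_cons (lebesgueRn n')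
  end.

Lemma lebesgueRn_box n (A : 'I_n -> set borelR) : (forall i, measurable (A i)) ->
  lebesgueRn n [set t | forall i, A i (tnth t i)] =
  \prod_(i < n) lebesgue_measure (A i).
Proof.
elim: n A => [|n IH] A mA.
  rewrite big_ord0 /= diracE (_ : _ \in _ = true) //.
  by apply/mem_set => -[].
rewrite big_ord_recl -IH // -product_measure1E //; last first.
  rewrite (_ : [set t | _] =
      \bigcap_i (fun t : point n => tnth t i) @^-1` A (lift ord0 i)).
    apply: fin_bigcap_measurable => // i _.
    by rewrite -[X in measurable X]setTI; exact: measurable_tnth.
  by apply/seteqP; split => t /= At i => [_|]; exact: At.
rewrite /= /lebesgue_cons /pushforward; congr (_ _).
apply/seteqP; split => -[a t] /= At.
  by split => [|i]; [exact: (At ord0) | move: (At (lift ord0 i)); rewrite tnthS].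
move=> i; case: (unliftP ord0 i) => [j ->|->]; last exact: At.1.
by rewrite tnthS; exact: At.2.
Qed.

Definition dm (n : nat) : {measure set (point n) -> \bar R} :=
  mscale (NngNum (powR_ge0 (2 * pi)%R (- (n%:R / 2))%R)) (lebesgueRn n).

End LebesgueMeasure.

Section CliffordFourier.
Variables (R : realType) (n : nat).
Local Notation G2n := (clifford R (n + n)).
Implicit Types (x y : 'rV[R]_n) (i : 'I_n).

(* Indices 'I_(n + n): the first half is e_1, ..., e_n, the second half is    *)
(* e'_1, ..., e'_n; a vector of R^(2n) is accordingly row_mx y y'.            *)
Definition ev i : G2n := egen R (lshift n i).
Definition ev' i : G2n := egen R (rshift n i).
Definition bivec i : G2n := ev i * ev' i.

Lemma bivec_sqr i : bivec i * bivec i = -1.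
Proof.
have e'e : ev' i * ev i = - (ev i * ev' i).
  by rewrite /ev /ev' egen_anticomm // eq_rlshift.
rewrite /bivec mulrA -[ev i * ev' i * ev i]mulrA e'e mulrN mulrA /ev /ev'.
by rewrite egen_sqr mul1r mulNr egen_sqr.
Qed.

Lemma bivec_comm i j : bivec i * bivec j = bivec j * bivec i.
Proof.
have [->//|ij] := eqVneq i j.
have ne : [/\ lshift n i != lshift n j, lshift n i != rshift n j,
    rshift n i != lshift n j & rshift n i != rshift n j].
  by rewrite eq_lshift eq_rshift eq_lrshift eq_rlshift.
case: ne => n1 n2 n3 n4; rewrite /bivec /ev /ev' -!mulrA.
rewrite (mulrA (egen R (rshift n i))) (egen_anticomm R n3) mulNr mulrN.
rewrite -!mulrA (egen_anticomm R n4) !mulrN opprK !mulrA (egen_anticomm R n1).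
rewrite !mulNr -!mulrA (mulrA (egen R (lshift n i))) (egen_anticomm R n2).
by rewrite mulNr mulrN opprK !mulrA.
Qed.

Definition rV_of_tuple (t : n.-tuple (measurableTypeR R)) : 'rV[R]_n :=
  \row_i tnth t i.

Definition cintegrable (g : 'rV[R]_n -> G2n) : Prop :=
  (forall I : {set 'I_(n + n)},
      measurable_fun setT (fun t => coef (g (rV_of_tuple t)) I)) /\
  (\int[dm R n]_t (`|g (rV_of_tuple t)|)%:E < +oo)%E.

Definition cintegral (g : 'rV[R]_n -> G2n) : G2n :=
  cmk (fun I => \int[dm R n]_t coef (g (rV_of_tuple t)) I).

Definition dotp x y : R := \sum_(i < n) x 0 i * y 0 i.

Definition Iform x y : G2n := \sum_(i < n) (x 0 i * y 0 i) *: bivec i.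

Definition Iform_ext x (yy : 'rV[R]_(n + n)) : G2n :=
  Iform x (lsubmx yy) - (dotp x (rsubmx yy))%:A.

Definition inv_cft (f : 'rV[R]_n -> G2n) x : G2n :=
  cintegral (fun t => cexp (Iform x t) * f t).

Definition F1 (g : 'rV[R]_n -> G2n) (yy : 'rV[R]_(n + n)) : G2n :=
  cintegral (fun x => cexp (- Iform_ext x yy) * g x).

Definition partial (g : 'rV[R]_(n + n) -> G2n) (k : 'I_(n + n))
    (yy : 'rV[R]_(n + n)) : G2n :=
  'D_(delta_mx 0 k) g yy.

Definition dirac_op (g : 'rV[R]_(n + n) -> G2n) (yy : 'rV[R]_(n + n)) : G2n :=
  \sum_(i < n) (ev i * partial g (lshift n i) yy +
                ev' i * partial g (rshift n i) yy).

(* M is meant to be open. *)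
Definition C1_on (M : set 'rV[R]_(n + n)) (g : 'rV[R]_(n + n) -> G2n) : Prop :=
  forall k yy, M yy ->
    derivable g yy (delta_mx 0 k) /\ {for yy, continuous (partial g k)}.

Definition monogenic (M : set 'rV[R]_(n + n)) (g : 'rV[R]_(n + n) -> G2n) : Prop :=
  C1_on M g /\ forall yy, M yy -> dirac_op g yy = 0.

End CliffordFourier.

(* Main.v *)
Require Import Defs.
From mathcomp Require Import all_boot all_order all_algebra.
From mathcomp Require Import ring lra.
From mathcomp Require Import all_classical all_reals all_analysis.
From mathcomp Require Import measurable_realfun measurable_fun_approximation.

Set Implicit Arguments.
Unset Strict Implicit.
Unset Printing Implicit Defensive.

Import Order.TTheory GRing.Theory Num.Theory.
Import numFieldNormedType.Exports.

Local Open Scope classical_set_scope.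
Local Open Scope ring_scope.

(** Throughout, [B_i = e_i e'_i] and [g] stands for the inverse transform of
    [f]. The statement has two halves of different nature.

    Monogenicity is differentiation under the integral sign. The [B_i] commute
    and square to -1, so the exponential of [I(x, y)] is the product [cis x y]
    of the rotations [cos (x_i y_i) + B_i sin (x_i y_i)] ([cexp_Iform]), and the
    extended kernel is [expR (x, y')] times [cis x (- y)] ([cexp_Iform_ext]).
    Along [e_i] it has logarithmic derivative [- x_i B_i], along [e'_i] it has
    logarithmic derivative [x_i]; since [e_i (- B_i) + e'_i = 0], the Dirac
    operator annihilates the integrand ([F1_monogenic]). The interchange and the continuity of the partial derivatives need an
    integrable bound that is uniform for [y'] in a neighbourhood: on a cube of
    half-width 1, [expR (x, y')] is at most the sum of its values at the [2 ^ n]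
    corners ([expR_dotp_corner]), where the integrability hypotheses apply.

    The restriction to [y' = 0] is Fourier inversion for a continuous
    integrable function with integrable transform ([F1_inv_cft]). The integral
    of [cis x (- y) * g x] is regularized by the product Fejer kernel
    [fejern d x], the product of the [(sin (d x_i / 2) / (d x_i / 2)) ^ 2],
    which is bounded by 1 and tends to 1 as [d] tends to 0. By Fubini's theorem the
    regularized integral is the mean of [f] against the Fourier transform of
    [fejern d], centred at [y] ([inv_cft_fejer]). Among summation kernels this
    one is convenient because its transform is, up to normalization, a product
    of triangle functions supported in [[-d, d]]: the mean then converges
    to [f y] by continuity alone ([tentn_approx]). In one variable the
    transform follows by polarization ([fejer_polarize]) from the integral of [(1 - cos (x s)) / x ^ 2]
    over the line, which is [pi |s|] ([integralT_fejer]); this in turn comes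
    from Tonelli's theorem, as [x ^- 2] is the Laplace transform of the
    identity. *)

(** * Norms and limits in the Clifford algebra *)

Lemma cvg_sumv {K : numFieldType} {V : pseudoMetricNormedZmodType K} {T J : Type}
    {F : set_system T} {FF : Filter F} (r : seq J) (u : J -> T -> V) (l : J -> V) :
  (forall j, u j x @[x --> F] --> l j) ->
  \sum_(j <- r) u j x @[x --> F] --> \sum_(j <- r) l j.
Proof.
move=> ul; elim: r => [|j r IH].
  by under eq_fun do rewrite big_nil; rewrite big_nil; exact: cvg_cst.
under eq_fun do rewrite big_cons.
by rewrite big_cons; apply: cvgD.
Qed.

Section CliffordNorm.
Context {R : realType} {m : nat}.
Local Notation cl := (clifford R m).
Implicit Types (A B : cl) (I J K : {set 'I_m}).

Lemma cl_coefN A I : coef (- A) I = - coef A I.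
Proof. by rewrite /coef ffunE. Qed.

Lemma cl_coefB A B I : coef (A - B) I = coef A I - coef B I.
Proof. by rewrite Defs.coefD cl_coefN. Qed.

(** Besides the Euclidean norm of the algebra, for which products are only
    controlled up to a dimensional constant, the l1 norm of the coordinates is
    used because it is submultiplicative. *)
Definition l1 A : R := \sum_I `|coef A I|.

Lemma l1_ge0 A : 0 <= l1 A.
Proof. by apply: sumr_ge0. Qed.

Lemma l1_0 : l1 0 = 0.
Proof. by rewrite /l1 big1 // => I _; rewrite Defs.coef0 normr0. Qed.

Lemma l1D A B : l1 (A + B) <= l1 A + l1 B.
Proof.
rewrite /l1 -big_split; apply: ler_sum => I _ /=.
by rewrite Defs.coefD ler_normD.
Qed.

Lemma l1Z (a : R) A : l1 (a *: A) = `|a| * l1 A.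
Proof. by rewrite /l1 mulr_sumr; apply: eq_bigr => I _; rewrite Defs.coefZ normrM. Qed.

Lemma l1_sum (T : Type) (r : seq T) (P : pred T) (F : T -> cl) :
  l1 (\sum_(i <- r | P i) F i) <= \sum_(i <- r | P i) l1 (F i).
Proof.
elim/big_rec2 : _ => [|i x y _ le]; first by rewrite l1_0.
by rewrite (le_trans (l1D _ _))// lerD2l.
Qed.

Lemma coef_le_l1 A I : `|coef A I| <= l1 A.
Proof. by rewrite /l1 (bigD1 I) //= lerDl sumr_ge0. Qed.

Lemma l1_ebasis I : l1 (ebasis R I) = 1.
Proof.
rewrite /l1 (bigD1 I) //= big1 ?addr0 => [|J /negPf IJ]; last first.
  by rewrite coef_ebasis IJ normr0.
by rewrite coef_ebasis eqxx normr1.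
Qed.

Lemma l1_1 : l1 1 = 1.
Proof. by rewrite -ebasis0 l1_ebasis. Qed.

Lemma esign_norm I J : `|esign R I J| = 1.
Proof.
have := congr1 Num.norm (esign_sqr R I J).
rewrite normrM normr1 => /eqP; rewrite -expr2 sqrf_eq1 => /orP[/eqP//|/eqP H].
by have := normr_ge0 (esign R I J); rewrite H ler0N1.
Qed.

Lemma l1M A B : l1 (A * B) <= l1 A * l1 B.
Proof.
rewrite {1}(clifford_sum A) {1}(clifford_sum B) mulr_suml.
apply: (le_trans (l1_sum _ _ _)); rewrite {2}/l1 mulr_suml.
apply: ler_sum => I _; rewrite mulr_sumr.
apply: (le_trans (l1_sum _ _ _)); rewrite {2}/l1 mulr_sumr.
apply: ler_sum => J _; rewrite -scalerAl -scalerAr ebasisM !l1Z l1_ebasis.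
by rewrite esign_norm !mulr1.
Qed.

Lemma l1X A k : l1 (A ^+ k) <= l1 A ^+ k.
Proof.
elim: k => [|k IH]; first by rewrite !expr0 l1_1.
by rewrite !exprS (le_trans (l1M _ _))// ler_wpM2l// l1_ge0.
Qed.

Lemma l1_prod_le (T : Type) (r : seq T) (F : T -> cl) (c : R) :
  (forall i, l1 (F i) <= c) -> l1 (\prod_(i <- r) F i) <= c ^+ size r.
Proof.
move=> Fc; elim: r => [|i r IH]; first by rewrite big_nil l1_1.
rewrite big_cons exprS (le_trans (l1M _ _))// ler_pM ?l1_ge0//.
Qed.

Lemma coef_le_norm A I : `|coef A I| <= `|A|.
Proof.
rewrite clifford_normE -sqrtr_sqr ler_sqrt ?sumr_ge0// => [|J _]; last first.
  exact: sqr_ge0.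
by rewrite (bigD1 I) //= lerDl sumr_ge0// => J _; exact: sqr_ge0.
Qed.

Lemma norm_ebasis I : `|ebasis R I| = 1.
Proof.
rewrite clifford_normE (bigD1 I) //= big1 => [|J /negPf IJ].
  by rewrite coef_ebasis eqxx expr1n addr0 sqrtr1.
by rewrite coef_ebasis IJ expr0n.
Qed.

Lemma norm_le_l1 A : `|A| <= l1 A.
Proof.
rewrite {1}(clifford_sum A) (le_trans (ler_norm_sum _ _ _))//.
by apply: ler_sum => I _; rewrite normrZ norm_ebasis mulr1.
Qed.

Lemma coef_continuous I : continuous (fun A : cl => coef A I).
Proof.
move=> A; apply/(@cvgrPdist_lt _ _ _ _ (nbhs_filter A)) => e e0.
apply/nbhs_normP; exists e => //= B; apply: le_lt_trans.
by rewrite -cl_coefB coef_le_norm.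
Qed.

Lemma cvg_coefP {T : Type} {F : set_system T} {FF : Filter F} (u : T -> cl) A :
  (forall I, coef (u x) I @[x --> F] --> coef A I) <-> u x @[x --> F] --> A.
Proof.
split=> [uA|uA I]; last first.
  exact: (continuous_cvg _ (@coef_continuous I A) uA).
rewrite (clifford_sum A) (_ : u = fun x => \sum_I coef (u x) I *: ebasis R I).
  by apply: cvg_sumv => I; apply: cvgZr_tmp; exact: uA.
by apply/funext => x; exact: clifford_sum.
Qed.

Lemma cvg_clM {T : Type} {F : set_system T} {FF : Filter F} (u v : T -> cl) A B :
  u x @[x --> F] --> A -> v x @[x --> F] --> B -> u x * v x @[x --> F] --> A * B.
Proof.
move=> /cvg_coefP uA /cvg_coefP vB; apply/cvg_coefP => K.
under eq_fun do rewrite coef_mul.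
rewrite coef_mul; apply: cvg_sumv => I.
by apply: cvgM; [apply: cvgM; [exact: cvg_cst|exact: uA]|exact: vB].
Qed.

Lemma cvg_cl_prod {T J : Type} {F : set_system T} {FF : Filter F} (r : seq J)
    (u : J -> T -> cl) (A : J -> cl) :
  (forall j, u j x @[x --> F] --> A j) ->
  \prod_(j <- r) u j x @[x --> F] --> \prod_(j <- r) A j.
Proof.
move=> uA; elim: r => [|j r IH].
  by under eq_fun do rewrite big_nil; rewrite big_nil; exact: cvg_cst.
under eq_fun do rewrite big_cons.
by rewrite big_cons; exact: cvg_clM.
Qed.

Lemma is_derive_coef {V : normedModType R} (g : V -> cl) (a v : V) A :
  (forall I, is_derive a v (fun x => coef (g x) I) (coef A I)) ->
  is_derive a v g A.
Proof.
move=> dg; have H : h^-1 *: (g (h *: v + a) - g a) @[h --> 0^'] --> A.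
  apply/cvg_coefP => I; under eq_fun do rewrite Defs.coefZ cl_coefB.
  have [/cvg_ex[l +] <-] := dg I; rewrite /derive.
  by move=> /[dup] /cvg_lim ->.
by apply: DeriveDef; [apply/cvg_ex; exists A|exact: cvg_lim H].
Qed.

End CliffordNorm.

(** * The exponential series *)

Section ExpPartialSums.
Context {R : realType} {L : algType R}.
Implicit Types A B : L.

Definition exp_sum A (N : nat) : L := \sum_(0 <= k < N) (k`!%:R : R)^-1 *: A ^+ k.

Lemma triangle_sum (F : nat -> nat -> L) N :
  \sum_(0 <= k < N) \sum_(0 <= i < k.+1) F (k - i)%N i =
  \sum_(0 <= i < N) \sum_(0 <= j < N | (i + j < N)%N) F j i.
Proof.
transitivity (\sum_(0 <= k < N) \sum_(0 <= i < N | (i <= k)%N) F (k - i)%N i).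
  by apply: eq_big_nat => k kN; rewrite (big_nat_widen 0 k.+1 N).
rewrite (exchange_big_dep_nat predT) //=; apply: eq_bigr => i _.
rewrite -(big_nat_widenl i 0 N predT)// -{1}[i]add0n big_addn.
rewrite (big_nat_widen 0 _ N) ?leq_subr//; apply: eq_big => j /=.
  by rewrite ltn_subRL.
by rewrite addnK.
Qed.

(** The Cauchy product of two truncated exponential series differs from the
    truncated series of the sum by the corner of the square above the
    antidiagonal; when [A] and [B] are positive reals all its terms are
    positive. *)
Lemma exp_sum_corner A B N : GRing.comm A B ->
  exp_sum A N * exp_sum B N - exp_sum (A + B) N =
  \sum_(0 <= i < N) \sum_(0 <= j < N | (N <= i + j)%N)
    ((j`!%:R : R)^-1 * (i`!%:R)^-1) *: (A ^+ j * B ^+ i).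
Proof.
move=> cAB; pose F j i : L := ((j`!%:R : R)^-1 * (i`!%:R)^-1) *: (A ^+ j * B ^+ i).
have -> : exp_sum (A + B) N =
    \sum_(0 <= i < N) \sum_(0 <= j < N | (i + j < N)%N) F j i.
  rewrite -triangle_sum; apply: eq_bigr => k _.
  rewrite exprDn_comm// big_mkord scaler_sumr; apply: eq_bigr => i _.
  rewrite -[X in _ *: X]scaler_nat scalerA; congr (_ *: _).
  have ik : (i <= k)%N by rewrite -ltnS.
  rewrite -invfM -natrM mulnC; apply: (@mulIf _ (k`!%:R)).
    by rewrite pnatr_eq0 -lt0n fact_gt0.
  rewrite mulrAC mulVf ?mul1r; last by rewrite pnatr_eq0 -lt0n fact_gt0.
  rewrite -(bin_fact ik) [X in _ * X]natrM mulrCA mulVf ?mulr1//.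
have -> : exp_sum A N * exp_sum B N = \sum_(0 <= i < N) \sum_(0 <= j < N) F j i.
  rewrite /exp_sum mulr_suml exchange_big /=; apply: eq_bigr => j _.
  rewrite mulr_sumr; apply: eq_bigr => i _.
  by rewrite -scalerAl -scalerAr scalerA.
rewrite -sumrB; apply: eq_bigr => i _.
rewrite (bigID (fun j => i + j < N)%N) /= addrAC subrr add0r.
by apply: eq_bigl => j; rewrite -leqNgt.
Qed.

End ExpPartialSums.

Section CliffordExp.
Context {R : realType} {m : nat}.
Local Notation cl := (clifford R m).
Implicit Types A B E F : cl.

(** Convergence is part of the predicate: [cexp] is a bare limit and determines
    nothing until its series is known to converge. *)
Definition is_exp A E := exp_sum A N @[N --> \oo] --> E.

Lemma is_exp_cexp A E : is_exp A E -> cexp A = E.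
Proof. by move=> AE; apply/cvg_lim. Qed.

Lemma cvg_exp_sum (x : R) : exp_sum (x : R^o) N @[N --> \oo] --> (expR x : R).
Proof.
rewrite /expR (_ : exp_sum _ = series (exp_coeff x)).
  exact: is_cvg_series_exp_coeff.
by apply/funext => N; apply: eq_bigr => k _; rewrite /exp_coeff /= mulrC.
Qed.

(** The corner left over by the Cauchy product is dominated, in the l1 norm, by
    the corner of the real series for [l1 A] and [l1 B], which tends to
    [expR (l1 A) * expR (l1 B) - expR (l1 A + l1 B) = 0]. *)
Lemma is_expD A B E F : GRing.comm A B ->
  is_exp A E -> is_exp B F -> is_exp (A + B) (E * F).
Proof.
move=> cAB AE BF; have AEBF : exp_sum A N * exp_sum B N @[N --> \oo] --> E * F.
  exact: cvg_clM.
pose a : R^o := l1 A; pose b : R^o := l1 B.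
pose r N : R := exp_sum a N * exp_sum b N - exp_sum (a + b) N.
have r0 : r N @[N --> \oo] --> 0.
  rewrite -(subrr (expR (l1 A + l1 B))) {1}expRD.
  by apply: cvgB; [apply: cvgM|]; exact: cvg_exp_sum.
suff d0 : exp_sum A N * exp_sum B N - exp_sum (A + B) N @[N --> \oo] --> (0 : cl).
  rewrite /is_exp -[E * F]subr0 (_ : exp_sum _ = fun N => exp_sum A N * exp_sum B N
      - (exp_sum A N * exp_sum B N - exp_sum (A + B) N)); first exact: cvgB.
  by apply/funext => N; rewrite subKr.
apply/cvg_coefP => I; rewrite Defs.coef0.
apply/norm_cvg0P; apply: (@squeeze_cvgr _ _ _ _ (cst 0) r) => //; last exact: cvg_cst.
apply: nearW => N /=; rewrite normr_ge0 /= (le_trans (coef_le_l1 _ _))//.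
rewrite exp_sum_corner// /r exp_sum_corner; last exact: mulrC.
apply: (le_trans (l1_sum _ _ _)); apply: ler_sum => i _.
apply: (le_trans (l1_sum _ _ _)); apply: ler_sum => j _.
rewrite l1Z ger0_norm ?mulr_ge0 ?invr_ge0// ler_wpM2l// ?mulr_ge0 ?invr_ge0//.
by rewrite (le_trans (l1M _ _))// ler_pM ?l1_ge0// l1X.
Qed.

Lemma is_exp0 : is_exp 0 1.
Proof.
apply: cvg_near_cst; exists 1%N => // -[//|N] _.
rewrite /exp_sum big_nat_recl// fact0 invr1 scale1r expr0.
by rewrite big1 ?addr0// => k _; rewrite expr0n scaler0.
Qed.

Lemma is_exp_sum (T : Type) (r : seq T) (A E : T -> cl) :
  (forall i j, GRing.comm (A i) (A j)) -> (forall i, is_exp (A i) (E i)) ->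
  is_exp (\sum_(i <- r) A i) (\prod_(i <- r) E i).
Proof.
move=> cA AE; elim: r => [|i r IH]; first by rewrite !big_nil; exact: is_exp0.
rewrite !big_cons; apply: is_expD => //.
by apply: commr_sum => j _; exact: cA.
Qed.

Lemma is_exp_scalar (a : R) : is_exp a%:A (expR a)%:A.
Proof.
rewrite /is_exp (_ : exp_sum _ = fun N => (exp_sum (a : R^o) N : R)%:A).
  by apply: cvgZr_tmp; exact: cvg_exp_sum.
apply/funext => N; rewrite /exp_sum scaler_suml; apply: eq_bigr => k _.
by rewrite -[a%:A]/(in_alg cl a) -rmorphXn /= scalerA.
Qed.

(** The powers of a square root [J] of -1 are those of the imaginary unit, so
    that the series of [a *: J] is, term by term, the cosine series plus [J]
    times the sine series. *)
Lemma is_exp_imaginary (J : cl) (a : R) : J * J = -1 ->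
  is_exp (a *: J) ((cos a)%:A + sin a *: J).
Proof.
move=> J2.
have JX k : J ^+ k = (-1) ^+ k./2 *: J ^+ odd k.
  rewrite -{1}(odd_double_half k) exprD -muln2 mulnC exprM expr2 J2.
  by rewrite -scaleN1r exprZn expr1n -scalerAr mulr1.
rewrite /is_exp (_ : exp_sum _ = fun N =>
    (series (cos_coeff a) N)%:A + series (sin_coeff a) N *: J).
  apply: cvgD; apply: cvgZr_tmp.
    by rewrite cos.unlock; exact: is_cvg_series_cos_coeff.
  by rewrite sin.unlock; exact: is_cvg_series_sin_coeff.
apply/funext => N; rewrite /exp_sum /series /= !scaler_suml -big_split /=.
apply: eq_bigr => k _; rewrite exprZn JX /cos_coeff /sin_coeff /=.
have -> : (-1) ^ k./2 = (-1) ^+ k./2 :> R by [].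
have [ko|ke] := boolP (odd k); rewrite /= ?(mul0r, mul1r) scale0r ?(addr0, add0r).
  have -> : k.-1./2 = k./2 by rewrite -{1}(odd_double_half k) ko /= doubleK.
  rewrite expr1 !scalerA.
  by congr (_ *: _); ring.
by rewrite expr0 !scalerA; congr (_ *: _); ring.
Qed.

End CliffordExp.

(** * The kernels of the Clifford-Fourier transforms *)

Section Kernel.
Context {R : realType} {n : nat}.
Local Notation G2n := (clifford R (n + n)).
Implicit Types (x y z : 'rV[R]_n) (yy : 'rV[R]_(n + n)) (i : 'I_n).

(** The closed form of [cexp (Iform x y)]; see [cexp_Iform]. *)
Definition cis x y : G2n :=
  \prod_(i < n) ((cos (x 0 i * y 0 i))%:A + sin (x 0 i * y 0 i) *: bivec R i).

Lemma comm_scalar (A : G2n) (a : R) : GRing.comm A a%:A.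
Proof. by rewrite /GRing.comm mulr_algl mulr_algr. Qed.

Lemma comm_bivecZ (a b : R) i j : GRing.comm (a *: bivec R i) (b *: bivec R j).
Proof.
rewrite /GRing.comm -!scalerAl -!scalerAr !scalerA (mulrC a b).
by rewrite bivec_comm.
Qed.

Lemma is_exp_Iform x y : is_exp (Iform x y) (cis x y).
Proof.
apply: is_exp_sum => [i j|i]; first exact: comm_bivecZ.
by apply: is_exp_imaginary; exact: bivec_sqr.
Qed.

Lemma cexp_Iform x y : cexp (Iform x y) = cis x y.
Proof. exact/is_exp_cexp/is_exp_Iform. Qed.

Lemma comm_Iform x y z : GRing.comm (Iform x y) (Iform x z).
Proof.
apply: commr_sum => j _; apply/commr_sym/commr_sum => k _.
exact: comm_bivecZ.
Qed.

Lemma IformD x y z : Iform x (y + z) = Iform x y + Iform x z.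
Proof.
rewrite /Iform -big_split; apply: eq_bigr => i _ /=.
by rewrite mxE mulrDr scalerDl.
Qed.

Lemma IformN x y : Iform x (- y) = - Iform x y.
Proof.
rewrite /Iform -sumrN; apply: eq_bigr => i _ /=.
by rewrite mxE mulrN scaleNr.
Qed.

Lemma Iform_delta x i (h : R) : Iform x (h *: delta_mx 0 i) = (x 0 i * h) *: bivec R i.
Proof.
rewrite /Iform (bigD1 i) //= big1 ?addr0 => [|j /negPf ji]; last first.
  by rewrite !mxE ji andbF !mulr0 scale0r.
by rewrite !mxE !eqxx mulr1.
Qed.

Lemma dotpD x y z : dotp x (y + z) = dotp x y + dotp x z.
Proof.
by rewrite /dotp -big_split; apply: eq_bigr => i _ /=; rewrite mxE mulrDr.
Qed.

Lemma dotp_delta x i (h : R) : dotp x (h *: delta_mx 0 i) = x 0 i * h.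
Proof.
rewrite /dotp (bigD1 i) //= big1 ?addr0 => [|j /negPf ji]; last first.
  by rewrite !mxE ji andbF !mulr0.
by rewrite !mxE !eqxx mulr1.
Qed.

Lemma cisD x y z : cis x (y + z) = cis x y * cis x z.
Proof.
rewrite -cexp_Iform IformD; apply: is_exp_cexp.
by apply: is_expD; [exact: comm_Iform|exact: is_exp_Iform..].
Qed.

Lemma cis_delta x i (h : R) :
  cis x (h *: delta_mx 0 i) = (cos (x 0 i * h))%:A + sin (x 0 i * h) *: bivec R i.
Proof.
rewrite -cexp_Iform Iform_delta; apply: is_exp_cexp.
by apply: is_exp_imaginary; exact: bivec_sqr.
Qed.

Lemma l1_bivec i : l1 (bivec R i) <= 1.
Proof. by rewrite (le_trans (l1M _ _))// !l1_ebasis mulr1. Qed.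

Lemma l1_cis x y : l1 (cis x y) <= 2 ^+ n.
Proof.
rewrite /cis -[X in _ <= _ ^+ X](size_enum_ord n) enumT.
apply: l1_prod_le => i; rewrite (le_trans (l1D _ _))// !l1Z l1_1 mulr1.
rewrite -[2]/(1 + 1) lerD//; first by rewrite ler_norml cos_geN1 cos_le1.
by rewrite mulr_ile1 ?l1_ge0// ?l1_bivec// ler_norml sin_geN1 sin_le1.
Qed.

Lemma cexp_Iform_ext x yy : cexp (- Iform_ext x yy) =
  expR (dotp x (rsubmx yy)) *: cis x (- lsubmx yy).
Proof.
apply: is_exp_cexp; rewrite /Iform_ext opprB addrC -IformN.
rewrite -[X in is_exp _ X]mulr1 -[X in is_exp _ X]scalerAl mulr1.
rewrite -[X in is_exp _ X]mulr1 -scalerAl scalerAr.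
by apply: is_expD; [exact: comm_scalar|exact: is_exp_Iform|exact: is_exp_scalar].
Qed.

(** The kernel is an exponential of commuting terms, so that a shift of its
    parameter along [e_i] factors out as a rotation in the plane of [1] and
    [B_i], and a shift along [e'_i] as a positive real factor. *)
Lemma kernel_shift_l x yy i (h : R) :
  cexp (- Iform_ext x (h *: delta_mx 0 (lshift n i) + yy)) =
  ((cos (x 0 i * h))%:A - sin (x 0 i * h) *: bivec R i) * cexp (- Iform_ext x yy).
Proof.
have dE : h *: delta_mx 0 (lshift n i) = row_mx (h *: delta_mx 0 i) 0 :> 'rV[R]_(n + n).
  by rewrite delta_mx_lshift scale_row_mx scaler0.
rewrite !cexp_Iform_ext dE linearD linearD /= row_mxKl row_mxKr add0r opprD cisD.
rewrite -scaleNr cis_delta mulrN cosN sinN scaleNr.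
by rewrite scalerAr.
Qed.

Lemma kernel_shift_r x yy i (h : R) :
  cexp (- Iform_ext x (h *: delta_mx 0 (rshift n i) + yy)) =
  expR (x 0 i * h) *: cexp (- Iform_ext x yy).
Proof.
have dE : h *: delta_mx 0 (rshift n i) = row_mx 0 (h *: delta_mx 0 i) :> 'rV[R]_(n + n).
  by rewrite delta_mx_rshift scale_row_mx scaler0.
rewrite !cexp_Iform_ext dE linearD linearD /= row_mxKl row_mxKr add0r dotpD.
by rewrite dotp_delta expRD scalerA.
Qed.

Lemma cis_cvg {T : Type} {F : set_system T} {FF : Filter F} x (u : T -> 'rV[R]_n) y :
  (forall i, u t 0 i @[t --> F] --> y 0 i) -> cis x (u t) @[t --> F] --> cis x y.
Proof.
move=> uy; apply: cvg_cl_prod => i.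
have xu : x 0 i * u t 0 i @[t --> F] --> x 0 i * y 0 i.
  by apply: cvgM; [exact: cvg_cst|exact: uy].
apply: cvgD; apply: cvgZr_tmp.
  exact: (continuous_cvg _ (@continuous_cos R _) xu).
exact: (continuous_cvg _ (@continuous_sin R _) xu).
Qed.

Lemma kernel_cvg {T : Type} {F : set_system T} {FF : Filter F} x
    (u : T -> 'rV[R]_(n + n)) yy :
  (forall k, u t 0 k @[t --> F] --> yy 0 k) ->
  cexp (- Iform_ext x (u t)) @[t --> F] --> cexp (- Iform_ext x yy).
Proof.
move=> uy; under eq_fun do rewrite cexp_Iform_ext.
rewrite cexp_Iform_ext; apply: cvgZ.
  apply: continuous_cvg; first exact: continuous_expR.
  rewrite /dotp; apply: cvg_sumv => i; apply: cvgM; first exact: cvg_cst.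
  by under eq_fun do rewrite mxE; rewrite mxE; exact: uy.
apply: cis_cvg => i; under eq_fun do rewrite !mxE.
by rewrite !mxE; apply: cvgN; exact: uy.
Qed.

Lemma l1_kernel x yy :
  l1 (cexp (- Iform_ext x yy)) <= 2 ^+ n * expR (dotp x (rsubmx yy)).
Proof.
rewrite cexp_Iform_ext l1Z ger0_norm ?expR_ge0// mulrC.
by rewrite ler_wpM2r ?expR_ge0// l1_cis.
Qed.

End Kernel.

(** * Integrals of functions with values in the Clifford algebra *)

Section RealIntegrals.
Context {d} {T : measurableType d} {R : realType}.
Variable mu : {measure set T -> \bar R}.
Implicit Types f g : T -> R.

Definition rintegrable f : Prop := mu.-integrable setT (EFin \o f).

Lemma rintegrable_meas f : rintegrable f -> measurable_fun setT f.
Proof. by move=> /measurable_int/measurable_EFinP. Qed.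

Lemma rintegrableD f g : rintegrable f -> rintegrable g ->
  rintegrable (fun t => f t + g t).
Proof. by move=> fi gi; have := integrableD measurableT fi gi. Qed.

Lemma rintegrableZ (a : R) f : rintegrable f -> rintegrable (fun t => a * f t).
Proof. by move=> fi; have := integrableZl measurableT a fi. Qed.

Lemma rintegrable_sum (I : Type) (s : seq I) (h : I -> T -> R) :
  (forall i, rintegrable (h i)) -> rintegrable (fun t => \sum_(i <- s) h i t).
Proof.
move=> hi; have := integrable_sum measurableT s (P := predT) (fun i _ => hi i).
by apply: eq_integrable => // t _; rewrite sumEFin.
Qed.

Lemma rintegrable_norm f : rintegrable f -> rintegrable (fun t => `|f t|).
Proof. by move=> fi; have := integrable_abse fi. Qed.

Lemma le_rintegrable f g : measurable_fun setT f -> (forall t, `|f t| <= g t) ->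
  rintegrable g -> rintegrable f.
Proof.
move=> mf fg; apply: le_integrable => //; first exact/measurable_EFinP.
by move=> t _; rewrite lee_fin (le_trans (fg t))// ler_norm.
Qed.

Lemma Rintegral_sum (I : Type) (s : seq I) (h : I -> T -> R) :
  (forall i, rintegrable (h i)) ->
  \int[mu]_t (\sum_(i <- s) h i t) = \sum_(i <- s) \int[mu]_t h i t.
Proof.
move=> hi; elim: s => [|i s IH].
  rewrite big_nil; under eq_Rintegral do rewrite big_nil.
  by rewrite Rintegral_cst// mul0r.
rewrite big_cons -IH -RintegralD//; [|exact: hi|exact: rintegrable_sum].
by under eq_Rintegral do rewrite big_cons.
Qed.

Lemma Rintegral_cvg (f_ : nat -> T -> R) f g :
  (forall k, measurable_fun setT (f_ k)) -> (forall t, f_ k t @[k --> \oo] --> f t) ->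
  (forall k t, `|f_ k t| <= g t) -> rintegrable g ->
  rintegrable f /\ \int[mu]_t f_ k t @[k --> \oo] --> \int[mu]_t f t.
Proof.
move=> mf_ f_f fg ig.
have mf : measurable_fun setT f by apply: measurable_fun_cvg mf_ _ => t _; exact: f_f.
have [] := @dominated_convergence _ _ _ mu setT measurableT
  (fun k t => (f_ k t)%:E) (EFin \o f) (EFin \o g) => //.
- by move=> k; exact/measurable_EFinP.
- exact/measurable_EFinP.
- by apply: aeW => t _; apply: cvg_EFin; [exact: nearW|exact: f_f].
- by apply: aeW => t k _; rewrite lee_fin.
move=> fi _ cf; split => //; apply: fine_cvg.
by rewrite fineK//; exact: integrable_fin_num.
Qed.

End RealIntegrals.

Section CliffordIntegral.
Context {d} {T : measurableType d} {R : realType} {m : nat}.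
Local Notation cl := (clifford R m).
Variable mu : {measure set T -> \bar R}.
Implicit Types (F G : T -> cl) (A : cl).

Definition clmeas F := forall I, measurable_fun setT (fun t => coef (F t) I).

Definition clintegrable F := forall I, rintegrable mu (fun t => coef (F t) I).

Definition clint F : cl := cmk (fun I => \int[mu]_t coef (F t) I).

Lemma clintegrable_meas F : clintegrable F -> clmeas F.
Proof. by move=> Fi I; exact: rintegrable_meas (Fi I). Qed.

Lemma coef_clint F I : coef (clint F) I = \int[mu]_t coef (F t) I.
Proof. exact: coef_mk. Qed.

Lemma clmeas_cst A : clmeas (fun=> A).
Proof. by move=> I; exact: measurable_cst. Qed.

Lemma clmeasD F G : clmeas F -> clmeas G -> clmeas (fun t => F t + G t).
Proof.
move=> mF mG I; under eq_fun do rewrite Defs.coefD.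
exact: measurable_funD.
Qed.

Lemma clmeasZ (f : T -> R) F : measurable_fun setT f -> clmeas F ->
  clmeas (fun t => f t *: F t).
Proof.
move=> mf mF I; under eq_fun do rewrite Defs.coefZ.
exact: measurable_funM.
Qed.

Lemma clmeasM F G : clmeas F -> clmeas G -> clmeas (fun t => F t * G t).
Proof.
move=> mF mG I; under eq_fun do rewrite coef_mul.
apply: measurable_sum => J; apply: measurable_funM => //.
by apply: measurable_funM => //; exact: measurable_cst.
Qed.

Lemma clmeas_prod (I : Type) (s : seq I) (F : I -> T -> cl) :
  (forall i, clmeas (F i)) -> clmeas (fun t => \prod_(i <- s) F i t).
Proof.
move=> mF; elim: s => [|i s IH].
  by under eq_fun do rewrite big_nil; exact: clmeas_cst.
by under eq_fun do rewrite big_cons; exact: clmeasM.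
Qed.

Lemma meas_clnorm F : clmeas F -> measurable_fun setT (fun t => `|F t|).
Proof.
move=> mF; under eq_fun do rewrite clifford_normE.
apply: measurableT_comp.
  by apply: continuous_measurable_fun; exact: sqrt_continuous.
by apply: measurable_sum => I; exact: measurable_funX.
Qed.

Lemma clintegrable_l1 F : clintegrable F -> rintegrable mu (fun t => l1 (F t)).
Proof. by move=> Fi; apply: rintegrable_sum => I; exact: rintegrable_norm. Qed.

Lemma le_clintegrable F (g : T -> R) : clmeas F -> (forall t, l1 (F t) <= g t) ->
  rintegrable mu g -> clintegrable F.
Proof.
move=> mF Fg gi I; apply: le_rintegrable gi => // t.
exact: le_trans (coef_le_l1 _ _) (Fg t).
Qed.

(** The Euclidean norm dominates each coordinate and is dominated by their l1
    sum, so integrability may be tested on coordinates. *)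
Lemma clintegrableP F :
  clintegrable F <-> clmeas F /\ (\int[mu]_t (`|F t|)%:E < +oo)%E.
Proof.
split=> [Fi|[mF Foo]].
  split; first exact: clintegrable_meas.
  have mF := clintegrable_meas Fi.
  have /integrableP[_] : rintegrable mu (fun t => `|F t|).
    apply: le_rintegrable (clintegrable_l1 Fi); first exact: meas_clnorm.
    by move=> t; rewrite normr_id norm_le_l1.
  by under eq_integral do rewrite /= normr_id.
have ni : rintegrable mu (fun t => `|F t|).
  apply/integrableP; split; first exact/measurable_EFinP/meas_clnorm.
  by under eq_integral do rewrite /= normr_id.
by move=> I; apply: le_rintegrable ni => // t; exact: coef_le_norm.
Qed.

Lemma clint_mull A F : clintegrable F -> clint (fun t => A * F t) = A * clint F.
Proof.
move=> Fi; apply: cliffordP => I; rewrite coef_clint coef_mul.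
under eq_Rintegral do rewrite coef_mul.
rewrite Rintegral_sum => [|J]; last by apply: rintegrableZ; exact: Fi.
by apply: eq_bigr => J _; rewrite RintegralZl ?coef_clint//; exact: Fi.
Qed.

Lemma clint_mulr A F : clintegrable F -> clint (fun t => F t * A) = clint F * A.
Proof.
move=> Fi; apply: cliffordP => I; rewrite coef_clint coef_mul.
under eq_Rintegral do rewrite coef_mul.
rewrite Rintegral_sum => [|J]; last first.
  under eq_fun do rewrite mulrAC.
  by apply: rintegrableZ; exact: Fi.
apply: eq_bigr => J _; rewrite coef_clint mulrAC -RintegralZl//; [|exact: Fi].
by under eq_Rintegral do rewrite mulrAC.
Qed.

Lemma clint_scale (a : R) F : clintegrable F -> clint (fun t => a *: F t) = a *: clint F.
Proof.
move=> Fi; rewrite -mulr_algl -clint_mull//; congr clint.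
by apply/funext => t; rewrite mulr_algl.
Qed.

Lemma clintD F G : clintegrable F -> clintegrable G ->
  clint (fun t => F t + G t) = clint F + clint G.
Proof.
move=> Fi Gi; apply: cliffordP => I; rewrite Defs.coefD !coef_clint.
by under eq_Rintegral do rewrite Defs.coefD; rewrite RintegralD//; [exact: Fi|exact: Gi].
Qed.

Lemma clint_sum (I : Type) (s : seq I) (F : I -> T -> cl) :
  (forall i, clintegrable (F i)) ->
  clint (fun t => \sum_(i <- s) F i t) = \sum_(i <- s) clint (F i).
Proof.
move=> Fi; apply: cliffordP => J; rewrite Defs.coef_sum coef_clint.
under eq_Rintegral do rewrite Defs.coef_sum.
rewrite Rintegral_sum => [|i]; last exact: Fi.
by apply: eq_bigr => i _; rewrite coef_clint.
Qed.

Lemma clintZ (f : T -> R) A : rintegrable mu f ->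
  clint (fun t => f t *: A) = (\int[mu]_t f t) *: A.
Proof.
move=> fi; apply: cliffordP => I; rewrite Defs.coefZ coef_clint -RintegralZr//.
by under eq_Rintegral do rewrite Defs.coefZ.
Qed.

Lemma clintegrableZ (f : T -> R) A : rintegrable mu f ->
  clintegrable (fun t => f t *: A).
Proof.
move=> fi I; under eq_fun do rewrite Defs.coefZ mulrC.
exact: rintegrableZ.
Qed.

Lemma clint_cvg (F_ : nat -> T -> cl) F (g : T -> R) :
  (forall k, clmeas (F_ k)) -> (forall t, F_ k t @[k --> \oo] --> F t) ->
  (forall k t, l1 (F_ k t) <= g t) -> rintegrable mu g ->
  clint (F_ k) @[k --> \oo] --> clint F.
Proof.
move=> mF_ F_F Fg gi; apply/cvg_coefP => I; rewrite coef_clint.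
under eq_fun do rewrite coef_clint.
apply: (Rintegral_cvg (f_ := fun k t => coef (F_ k t) I) _ _ _ gi).2 => [k|t|k t].
- exact: mF_.
- by have /cvg_coefP := F_F t; exact.
- exact: le_trans (coef_le_l1 _ _) (Fg k t).
Qed.

End CliffordIntegral.

(** * Monogenicity of the exponential integral *)

(** Dominated convergence is a statement about sequences; this turns it into
    continuity of an integral in a vector parameter. *)
Lemma seq_continuous_for {R : realType} {V W : normedModType R} (f : V -> W) (a : V) :
  (forall u : nat -> V, u k @[k --> \oo] --> a -> f (u k) @[k --> \oo] --> f a) ->
  {for a, continuous f}.
Proof.
move=> fseq; apply/(@cvgrPdist_lt _ _ _ _ (nbhs_filter a)) => e e0.
apply: contrapT => nf.
have /choice[u /all_and2[ua uf]] : forall k : nat,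
    exists x, `|a - x| < k.+1%:R^-1 /\ e <= `|f a - f x|.
  move=> k; apply: contrapT => nx; apply: nf.
  apply/nbhs_normP; exists k.+1%:R^-1 => /=; first by rewrite invr_gt0.
  move=> x ax /=; rewrite ltNge; apply/negP => ex; apply: nx.
  by exists x.
have /fseq/cvgrPdist_lt/(_ _ e0)[N _ /(_ N (leqnn N))] : u k @[k --> \oo] --> a.
  apply/cvgrPdist_lt => r r0; near=> k.
  apply: lt_trans (ua k) _.
  by near: k; exact: near_infty_natSinv_lt (PosNum r0).
by rewrite /= ltNge uf.
Unshelve. all: by end_near. Qed.

Section MeasurableKernel.
Context {d} {T : measurableType d} {R : realType} {n : nat}.
Implicit Types u v : T -> 'rV[R]_n.

Definition rvmeas u := forall i, measurable_fun setT (fun t => u t 0 i).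

Lemma rvmeas_cst (y : 'rV[R]_n) : rvmeas (fun=> y).
Proof. by move=> i; exact: measurable_cst. Qed.

Lemma meas_dotp u v : rvmeas u -> rvmeas v ->
  measurable_fun setT (fun t => dotp (u t) (v t)).
Proof.
move=> mu mv; apply: measurable_sum => i.
exact: measurable_funM.
Qed.

Lemma clmeas_cis u v : rvmeas u -> rvmeas v -> clmeas (fun t => cis (u t) (v t)).
Proof.
move=> mu mv; apply: clmeas_prod => i.
have muv : measurable_fun setT (fun t => u t 0 i * v t 0 i) by exact: measurable_funM.
apply: clmeasD; apply: clmeasZ; try exact: clmeas_cst.
  by apply: measurableT_comp muv; apply: continuous_measurable_fun; exact: continuous_cos.
by apply: measurableT_comp muv; apply: continuous_measurable_fun; exact: continuous_sin.
Qed.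

End MeasurableKernel.

Section Monogenic.
Context {R : realType} {n : nat}.
Local Notation G2n := (clifford R (n + n)).
Local Notation X := (@rV_of_tuple R n).
Local Notation mu := (dm R n).
Implicit Types (x y z : 'rV[R]_n) (yy zz : 'rV[R]_(n + n)) (i : 'I_n).

Lemma rvmeas_point : rvmeas X.
Proof.
move=> i; under eq_fun do rewrite mxE.
exact: measurable_tnth.
Qed.

Lemma cintegrableP (g : 'rV[R]_n -> G2n) :
  cintegrable g <-> clintegrable mu (fun t => g (X t)).
Proof. by rewrite clintegrableP. Qed.

Lemma clmeas_kernel yy : clmeas (fun t => cexp (- Iform_ext (X t) yy)).
Proof.
under eq_fun do rewrite cexp_Iform_ext.
apply: clmeasZ; last by apply: clmeas_cis; [exact: rvmeas_point|exact: rvmeas_cst].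
apply: measurableT_comp => //.
by apply: meas_dotp; [exact: rvmeas_point|exact: rvmeas_cst].
Qed.

Definition corner (s : {ffun 'I_n -> bool}) : 'rV[R]_n := \row_j (-1) ^+ s j.

(** One coordinate at a time, [expR (x_j z_j)] is at most
    [expR x_j + expR (- x_j)]; multiplying out gives one term for each corner of
    the cube. *)
Lemma expR_dotp_corner x z : (forall j, `|z 0 j| <= 1) ->
  expR (dotp x z) <= \sum_(s : {ffun 'I_n -> bool}) expR (dotp x (corner s)).
Proof.
move=> z1; rewrite /dotp expR_sum.
under [leRHS]eq_bigr => s _ do rewrite /dotp expR_sum.
pose F j (b : bool) := expR (x 0 j * (-1) ^+ b).
rewrite (eq_bigr (fun s : {ffun 'I_n -> bool} => \prod_j F j (s j))); last first.
  by move=> s _; apply: eq_bigr => j _; rewrite mxE.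
rewrite -(bigA_distr_bigA F); apply: ler_prod => j _; rewrite expR_ge0 /=.
rewrite big_bool /F /= expr1 expr0 mulr1 mulrN1.
have : x 0 j * z 0 j <= `|x 0 j|.
  by rewrite (le_trans (ler_norm _))// normrM ler_piMr.
rewrite -ler_expR => /le_trans; apply.
by case: ger0P => _; rewrite ?lerDl ?lerDr expR_ge0.
Qed.

Variable g : 'rV[R]_n -> G2n.
Hypothesis mg : clmeas (fun t => g (X t)).
Hypothesis g_exp : forall z,
  clintegrable mu (fun t => expR (dotp (X t) z) *: g (X t)).
Hypothesis g_mexp : forall z i,
  clintegrable mu (fun t => (X t 0 i * expR (dotp (X t) z)) *: g (X t)).

Lemma clmeas_kernelM yy : clmeas (fun t => cexp (- Iform_ext (X t) yy) * g (X t)).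
Proof. exact: clmeasM (clmeas_kernel yy) mg. Qed.

Lemma l1_kernelM yy x :
  l1 (cexp (- Iform_ext x yy) * g x) <= 2 ^+ n * l1 (expR (dotp x (rsubmx yy)) *: g x).
Proof.
rewrite (le_trans (l1M _ _))// l1Z ger0_norm ?expR_ge0// mulrA.
by rewrite ler_wpM2r ?l1_ge0// l1_kernel.
Qed.

Lemma clintegrable_kernelM yy :
  clintegrable mu (fun t => cexp (- Iform_ext (X t) yy) * g (X t)).
Proof.
apply: le_clintegrable (clmeas_kernelM yy) (fun t => l1_kernelM yy (X t)) _.
exact/rintegrableZ/clintegrable_l1/g_exp.
Qed.

(** The integrable bound, valid for all parameters [zz] whose second half differs
    by at most 1 in each coordinate from that of [yy], for the integrands of the derivatives. *)
Let dom i yy (t : n.-tuple (measurableTypeR R)) : R := \sum_(s : {ffun 'I_n -> bool})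
  2 ^+ n * l1 ((X t 0 i * expR (dotp (X t) (rsubmx yy + corner s))) *: g (X t)).

Let dom_int i yy : rintegrable mu (dom i yy).
Proof.
by apply: rintegrable_sum => s; exact/rintegrableZ/clintegrable_l1/g_mexp.
Qed.

Let dom_ub i yy zz t : (forall j, `|zz 0 (rshift n j) - yy 0 (rshift n j)| <= 1) ->
  `|X t 0 i| * l1 (cexp (- Iform_ext (X t) zz) * g (X t)) <= dom i yy t.
Proof.
move=> zy; apply: (le_trans (ler_wpM2l _ (l1_kernelM _ _))) => //.
rewrite mulrCA /dom -mulr_sumr ler_wpM2l// l1Z mulrA -normrM.
under eq_bigr do rewrite l1Z normrM dotpD expRD normrM.
rewrite -!mulr_suml normrM ler_wpM2r ?l1_ge0// -!mulr_sumr ler_wpM2l//.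
have -> : rsubmx zz = rsubmx yy + (rsubmx zz - rsubmx yy) by rewrite addrC subrK.
rewrite dotpD expRD normrM ler_wpM2l// (eq_bigr (fun s => expR (dotp (X t) (corner s)))).
  by rewrite ger0_norm ?expR_ge0// expR_dotp_corner// => j; rewrite !mxE.
by move=> s _; rewrite ger0_norm ?expR_ge0.
Qed.

(** The common form of the partial derivatives of [F1 g]: [A] is [- B_i] in the
    direction [e_i], and [1] in the direction [e'_i]. *)
Let moment i (A : G2n) yy :=
  clint mu (fun t => X t 0 i *: (A * (cexp (- Iform_ext (X t) yy) * g (X t)))).

Let moment_meas i A yy :
  clmeas (fun t => X t 0 i *: (A * (cexp (- Iform_ext (X t) yy) * g (X t)))).
Proof.
apply: clmeasZ; first exact: rvmeas_point.
by apply: clmeasM; [exact: clmeas_cst|exact: clmeas_kernelM].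
Qed.

Let moment_ub i A yy zz t : (forall k, `|zz 0 k - yy 0 k| <= 1) ->
  l1 (X t 0 i *: (A * (cexp (- Iform_ext (X t) zz) * g (X t)))) <= l1 A * dom i yy t.
Proof.
move=> zy; rewrite l1Z (le_trans (ler_wpM2l _ (l1M _ _)))// mulrCA.
by rewrite ler_wpM2l ?l1_ge0// dom_ub.
Qed.

Let moment_continuous i A yy : {for yy, continuous (moment i A)}.
Proof.
apply: seq_continuous_for => u uy.
have uyk k : u m 0 k @[m --> \oo] --> yy 0 k.
  exact: (continuous_cvg _ (@coord_continuous _ _ _ 0 k yy) uy).
have [N _ uN] : \forall m \near \oo, forall k, `|u m 0 k - yy 0 k| <= 1.
  apply: filter_forall => k; have /cvgrPdist_le/(_ 1 ltr01) := uyk k.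
  by apply: filterS => m; rewrite distrC.
rewrite -(cvg_shiftn N).
apply: (clint_cvg (g := fun t => l1 A * dom i yy t)) => [m|t|m t|].
- exact: moment_meas.
- apply: cvgZ; first exact: cvg_cst.
  apply: cvg_clM; first exact: cvg_cst.
  apply: cvg_clM; last exact: cvg_cst.
  by apply: kernel_cvg => k; have := uyk k; rewrite -(cvg_shiftn N).
- by apply: moment_ub => k; apply: uN; exact: leq_addl.
- exact/rintegrableZ/dom_int.
Qed.

Let is_derive_F1_gen i (A : G2n) yy (v : 'rV[R]_(n + n)) :
  (forall k, `|v 0 k| <= 1) ->
  (forall x K (h : R), is_derive h 1
     (fun h => coef (cexp (- Iform_ext x (h *: v + yy)) * g x) K)
     (coef (x 0 i *: (A * (cexp (- Iform_ext x (h *: v + yy)) * g x))) K)) ->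
  is_derive yy v (F1 g) (moment i A yy).
Proof.
move=> v1 dk; apply: is_derive_coef => K.
pose f (h : R) t : R := coef (cexp (- Iform_ext (X t) (h *: v + yy)) * g (X t)) K.
have d1f h t : derive1 (f ^~ t) h =
    coef (X t 0 i *: (A * (cexp (- Iform_ext (X t) (h *: v + yy)) * g (X t)))) K.
  by rewrite derive1E; exact: (@derive_val _ _ _ _ _ _ _ (dk (X t) K h)).
pose Fc (h : R) := \int[mu]_t f h t.
have FcE h : Fc h = coef (F1 g (h *: v + yy)) K by rewrite coef_mk.
have dF : h^-1 *: (Fc (h + 0) - Fc 0) @[h --> 0^'] --> coef (moment i A yy) K.
  rewrite /moment coef_clint.
  rewrite (_ : \int[mu]_t _ = \int[mu]_(t in setT) partial1of2 f 0 t); last first.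
    by apply: eq_Rintegral => t _; rewrite /partial1of2 d1f scale0r add0r.
  apply: (@cvg_differentiation_under_integral R _ _ mu f setT measurableT 0 (-1) 1
    _ _ _ (fun t => l1 A * dom i yy t)).
  - by rewrite /= in_itv /= ltrN10 ltr01.
  - by move=> h _; exact: clintegrable_kernelM.
  - by move=> h t _ _; exact: (@ex_derive _ _ _ _ _ _ _ (dk (X t) K h)).
  - move=> t; rewrite mulr_ge0 ?l1_ge0// /dom sumr_ge0// => s _.
    by rewrite mulr_ge0 ?l1_ge0.
  - exact/rintegrableZ/dom_int.
  - move=> h t; rewrite /= in_itv /= => /andP[h1 h2] _; rewrite /partial1of2 d1f.
    rewrite (le_trans (coef_le_l1 _ _))// moment_ub// => k.
    by rewrite !mxE addrK normrM mulr_ile1// ler_norml !ltW.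
have {}dF : h^-1 *: (coef (F1 g (h *: v + yy)) K - coef (F1 g yy) K) @[h --> 0^'] -->
    coef (moment i A yy) K.
  move: dF; under eq_fun do rewrite addr0 !FcE scale0r add0r.
  exact.
apply: DeriveDef; last exact: cvg_lim dF.
by apply/cvg_ex; exists (coef (moment i A yy) K).
Qed.

Let delta_le1 k (j : 'I_(n + n)) : `|(delta_mx 0 k : 'rV[R]_(n + n)) 0 j| <= 1.
Proof. by rewrite mxE; case: (_ && _); rewrite ?normr1 ?normr0. Qed.

Lemma is_derive_F1_l i yy :
  is_derive yy (delta_mx 0 (lshift n i) : 'rV[R]_(n + n)) (F1 g)
    (moment i (- bivec R i) yy).
Proof.
apply: is_derive_F1_gen => [j|x K h]; first exact: delta_le1.
pose W := cexp (- Iform_ext x yy) * g x.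
have kE (k : R) : cexp (- Iform_ext x (k *: delta_mx 0 (lshift n i) + yy)) * g x =
    cos (x 0 i * k) *: W - sin (x 0 i * k) *: (bivec R i * W).
  by rewrite kernel_shift_l -mulrA -/W mulrBl mulr_algl -scalerAl.
clearbody W.
under eq_fun do rewrite kE cl_coefB !Defs.coefZ.
rewrite kE mulNr mulrBr -!scalerAr (mulrA (bivec R i)) bivec_sqr mulN1r.
rewrite !(Defs.coefZ, cl_coefB, cl_coefN).
apply: is_derive_eq.
by rewrite /GRing.scale /=; ring.
Qed.

Lemma is_derive_F1_r i yy :
  is_derive yy (delta_mx 0 (rshift n i) : 'rV[R]_(n + n)) (F1 g) (moment i 1 yy).
Proof.
apply: is_derive_F1_gen => [j|x K h]; first exact: delta_le1.
rewrite mul1r.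
under eq_fun do rewrite kernel_shift_r -scalerAl Defs.coefZ.
rewrite kernel_shift_r -scalerAl !Defs.coefZ.
apply: is_derive_eq.
by rewrite /GRing.scale /=; ring.
Qed.

(** Left multiplication by [e_i] and [e'_i] goes inside the integral, where the
    two contributions of the index [i] cancel because [e_i B_i = e'_i]. *)
Lemma F1_monogenic : monogenic setT (F1 g).
Proof.
have pl i : partial (F1 g) (lshift n i) = moment i (- bivec R i).
  by apply/funext => yy; exact: (@derive_val _ _ _ _ _ _ _ (is_derive_F1_l i yy)).
have pr i : partial (F1 g) (rshift n i) = moment i 1.
  by apply/funext => yy; exact: (@derive_val _ _ _ _ _ _ _ (is_derive_F1_r i yy)).
split=> [k yy _|yy _].
  case: (split_ordP k) => i ->; rewrite ?pl ?pr; split; try exact: moment_continuous.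
    exact: (@ex_derive _ _ _ _ _ _ _ (is_derive_F1_l i yy)).
  exact: (@ex_derive _ _ _ _ _ _ _ (is_derive_F1_r i yy)).
rewrite /dirac_op big1 // => i _; rewrite pl pr /moment.
have mi A : clintegrable mu
    (fun t => X t 0 i *: (A * (cexp (- Iform_ext (X t) yy) * g (X t)))).
  apply: (le_clintegrable (g := fun t => l1 A * dom i yy t)).
  - exact: moment_meas.
  - by move=> t; apply: moment_ub => k; rewrite subrr normr0.
  - exact/rintegrableZ/dom_int.
have bE : ev R i * - bivec R i = - ev' R i.
  by rewrite mulrN /bivec mulrA egen_sqr mul1r.
have momentM (A B : G2n) : A * moment i B yy = moment i (A * B) yy.
  rewrite /moment -clint_mull//; congr clint; apply/funext => t.
  by rewrite -scalerAr (mulrA A B).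
rewrite !momentM bE mulr1 /moment -clintD//.
apply: cliffordP => K; rewrite coef_clint Defs.coef0.
under eq_Rintegral do rewrite -scalerDr mulNr addNr scaler0 Defs.coef0.
by rewrite Rintegral_cst// mul0r.
Qed.

End Monogenic.

(** * The Fejer kernel on the line *)

Section ImproperIntegrals.
Context {R : realType}.
Local Notation leb := (@lebesgue_measure R).
Implicit Types f F : R -> R.

Lemma ge0_integralT_fold f : (forall x, 0 <= f x) -> continuous f ->
  (\int[leb]_x (f x)%:E =
   \int[leb]_(x in `[0%R, +oo[) (f x)%:E + \int[leb]_(x in `[0%R, +oo[) (f (- x))%:E)%E.
Proof.
move=> f0 cf.
have mf : measurable_fun [set: R] f by exact: continuous_measurable_fun.
rewrite -(setUv (`[0%R, +oo[ : set R)) ge0_integral_setU//= ; last 4 first.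
  exact: measurableC.
  by apply/measurable_EFinP; rewrite setUv.
  by move=> x _; rewrite lee_fin.
  exact/disj_setPCl.
congr +%E; rewrite setCitvr.
rewrite integral_itv_bndo_bndc; last exact/measurable_EFinP/measurable_funTS.
rewrite -{1}oppr0 ge0_integration_by_substitutionNy//.
exact: continuous_subspaceT.
Qed.

Lemma ge0_integralT_opp f : (forall x, 0 <= f x) -> continuous f ->
  (\int[leb]_x (f (- x))%:E = \int[leb]_x (f x)%:E)%E.
Proof.
move=> f0 cf; rewrite !ge0_integralT_fold//.
  by under [X in (_ + X)%E = _]eq_integral do rewrite opprK; rewrite addeC.
by move=> x; apply: continuous_comp; [exact: opp_continuous|exact: cf].
Qed.

Lemma is_derive_continuous f (x d : R) : is_derive x (1 : R) f d -> {for x, continuous f}.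
Proof. by case=> df _; apply/differentiable_continuous/derivable1_diffP. Qed.

Lemma ge0_integral0y f F (l : R) : (forall x, 0 <= x -> 0 <= f x) -> continuous f ->
  (forall x, is_derive x (1 : R) F (f x)) -> F x @[x --> +oo] --> l ->
  (\int[leb]_(x in `[0%R, +oo[) (f x)%:E = (l - F 0)%:E)%E.
Proof.
move=> f0 cf dF Fl.
have cF : continuous F.
  by move=> x; exact: is_derive_continuous (dF x).
rewrite EFinB; apply: ge0_continuous_FTC2y => //.
- exact: continuous_subspaceT.
- by apply: cvg_at_right_filter; exact: cF.
- by move=> x _; rewrite derive1E; have [] := dF x.
Qed.

Lemma ge0_integralT_FTC f F (l l' : R) : (forall x, 0 <= f x) -> continuous f ->
  (forall x, is_derive x (1 : R) F (f x)) ->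
  F x @[x --> +oo] --> l -> F x @[x --> -oo] --> l' ->
  (\int[leb]_x (f x)%:E = (l - l')%:E)%E.
Proof.
move=> f0 cf dF Fl Fl'.
have If : (\int[leb]_(x in `[0%R, +oo[) (f x)%:E = (l - F 0)%:E)%E.
  by apply: ge0_integral0y => //.
have IfN : (\int[leb]_(x in `[0%R, +oo[) (f (- x))%:E = (- l' - - F (- 0))%:E)%E.
  apply: (ge0_integral0y (f := f \o -%R) (F := fun x => - F (- x))) => [x _|x|x|].
  - exact: f0.
  - by apply: continuous_comp; [exact: opp_continuous|exact: cf].
  - have dN : is_derive x (1 : R) (-%R : R -> R) (- 1).
      exact: is_deriveN (is_derive_id x (1 : R)).
    have := is_deriveN (is_derive1_comp (dF (- x)) dN).
    by rewrite mulrN1 opprK.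
  - by apply: cvgN; apply/(cvgNy_compNP F).
rewrite ge0_integralT_fold// If IfN -EFinD oppr0 opprK; congr EFin.
by ring.
Qed.

End ImproperIntegrals.

Section Sinc.
Context {R : realType}.
Implicit Types x s : R.

Definition sinc x : R := if x == 0 then 1 else sin x / x.

Lemma sinc_neq0 x : x != 0 -> sinc x = sin x / x.
Proof. by rewrite /sinc => /negPf ->. Qed.

Lemma sinc_continuous : continuous sinc.
Proof.
move=> x; have [->|x0] := eqVneq x 0; last first.
  have n0 : nbhs x [set y : R | y != 0].
    by apply: open_nbhs_nbhs; split; [exact: open_neq|].
  apply: (@cvg_trans _ ((fun y => sin y / y) @ x)).
    apply: near_eq_cvg; near=> y; rewrite /= sinc_neq0//.
    by near: y; exact: n0.
  rewrite sinc_neq0//; apply: continuousM; first exact: continuous_sin.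
  exact: inv_continuous.
apply/continuous_withinNx; rewrite {2}/sinc eqxx.
have /cvg_ex[l sl] : derivable (@sin R) 0 1 by exact: derivable_sin.
have l1 : l = 1 by rewrite -(cvg_lim _ sl)// -[lim _]/('D_1 sin 0) derive_val cos0.
rewrite -[X in _ --> X]l1; apply: cvg_trans sl; apply: near_eq_cvg; near=> h.
rewrite /= addr0 sin0 subr0 sinc_neq0; last by near: h; exact: nbhs_dnbhs_neq.
by rewrite /GRing.scale /= mulr1 mulrC.
Unshelve. all: by end_near. Qed.

Lemma sin_le_norm x : `|sin x| <= `|x|.
Proof.
wlog x0 : x / 0 < x => [H|].
  have [x0|x0|->] := ltgtP x 0; last by rewrite sin0.
    by rewrite -normrN -sinN -[leRHS]normrN H// oppr_gt0.
  exact: H.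
have [|c _] := @MVT R sin cos 0 x x0.
  by apply: continuous_subspaceT; exact: continuous_sin.
rewrite sin0 !subr0 => ->.
by rewrite normrM ler_piMl// ler_norml cos_geN1 cos_le1.
Qed.

Lemma sinc_le1 x : `|sinc x| <= 1.
Proof.
have [->|x0] := eqVneq x 0; first by rewrite /sinc eqxx normr1.
by rewrite sinc_neq0// normf_div ler_pdivrMr ?normr_gt0// mul1r sin_le_norm.
Qed.

(** Up to the factor [s ^ 2 / 2], the continuous extension to [x = 0] of
    [(1 - cos (x s)) / x ^ 2]; see [fejer_cos]. *)
Definition fejer s x : R := sinc (x * s / 2) ^+ 2.

Lemma fejer_ge0 s x : 0 <= fejer s x. Proof. exact: sqr_ge0. Qed.

Lemma fejer_le1 s x : fejer s x <= 1.
Proof. by rewrite /fejer -real_normK ?num_real// expr_le1// sinc_le1. Qed.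

Lemma fejer_continuous s : continuous (fejer s).
Proof.
move=> x; have cs : {for x, continuous (fun x => sinc (x * s / 2))}.
  apply: (@continuous_comp _ _ _ (fun x => x * s / 2) sinc).
    by apply: continuousM; [apply: continuousM => //|]; exact: cst_continuous.
  exact: sinc_continuous.
exact: (continuousM cs cs).
Qed.

Lemma sincN x : sinc (- x) = sinc x.
Proof. by rewrite /sinc oppr_eq0 sinN invrN mulrNN. Qed.

Lemma fejerNl s x : fejer (- s) x = fejer s x.
Proof. by rewrite /fejer mulrN mulNr sincN. Qed.

Lemma fejerNr s x : fejer s (- x) = fejer s x.
Proof. by rewrite /fejer !mulNr sincN. Qed.

Lemma fejer_cos s x : x != 0 -> s ^+ 2 / 2 * fejer s x = (1 - cos (x * s)) / x ^+ 2.
Proof.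
move=> x0; have [->|s0] := eqVneq s 0.
  by rewrite mulr0 cos0 subrr expr0n !mul0r.
rewrite /fejer sinc_neq0 ?mulf_neq0 ?invr_neq0//.
have -> : cos (x * s) = 1 - 2 * sin (x * s / 2) ^+ 2.
  rewrite {1}(_ : x * s = (x * s / 2) *+ 2); last by rewrite -mulr_natr -mulrA mulVf ?mulr1.
  by rewrite cos_mulr2n cos2sin2; ring.
by field; rewrite x0 s0.
Qed.

Lemma fejer_cvg1 x (u : nat -> R) : u k @[k --> \oo] --> 0 ->
  fejer (u k) x @[k --> \oo] --> (1 : R).
Proof.
move=> u0; have uc : sinc (x * u k / 2) @[k --> \oo] --> (1 : R).
  rewrite [X in _ --> X](_ : _ = sinc (x * 0 / 2)); last by rewrite mulr0 mul0r /sinc eqxx.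
  apply: continuous_cvg; first exact: sinc_continuous.
  by apply: cvgM; [apply: cvgM; [exact: cvg_cst|exact: u0]|exact: cvg_cst].
rewrite -[X in _ --> X]mulr1 /fejer; under eq_fun do rewrite expr2.
exact: cvgM.
Qed.

(** The addition formulas turn the product with a cosine into a second
    difference in [s], so that the cosine transform of the kernel reduces to
    integrals of such kernels alone. *)
Lemma fejer_polarize (d s x : R) : d ^+ 2 * (fejer d x * cos (x * s)) =
  (s + d) ^+ 2 / 2 * fejer (s + d) x + (s - d) ^+ 2 / 2 * fejer (s - d) x
  - s ^+ 2 * fejer s x.
Proof.
have [->|x0] := eqVneq x 0.
  by rewrite /fejer !mul0r /sinc eqxx cos0; field.
have E : d ^+ 2 * fejer d x = 2 * ((1 - cos (x * d)) / x ^+ 2).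
  by rewrite -fejer_cos//; field.
have E' : s ^+ 2 * fejer s x = 2 * ((1 - cos (x * s)) / x ^+ 2).
  by rewrite -fejer_cos//; field.
rewrite mulrA E E' !fejer_cos// mulrBr mulrDr cosD cosB.
by ring.
Qed.

End Sinc.

Section FejerIntegral.
Context {R : realType}.
Local Notation leb := (@lebesgue_measure R).

Lemma cvg_bounded_exp (u C : R) (f : R -> R) : 0 < u ->
  (forall x, 0 <= x -> `|f x| <= C) -> f x * expR (- (x * u)) @[x --> +oo] --> (0 : R).
Proof.
move=> u0 fC.
have e0 : expR (- (x * u)) @[x --> +oo] --> (0 : R).
  apply: (@cvg_comp _ _ _ (fun x : R => x * u) (fun x => expR (- x)) +oo +oo).
    exact: gt0_cvgMly.
  exact: cvgr_expR.
apply/norm_cvg0P; apply: (@squeeze_cvgr _ _ _ _ (cst 0) (fun x => C * expR (- (x * u)))).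
- near=> x; rewrite normr_ge0 /= normrM (ger0_norm (expR_ge0 _)).
  by rewrite ler_wpM2r ?expR_ge0// fC.
- exact: cvg_cst.
- by rewrite -(mulr0 C); apply: cvgM => //; exact: cvg_cst.
Unshelve. all: by end_near. Qed.

Lemma integral_laplace_id (x : R) : 0 < x ->
  (\int[leb]_(u in `[0%R, +oo[) (u * expR (- (u * x)))%:E = (x ^- 2)%:E)%E.
Proof.
move=> x0; have xn0 : x != 0 by rewrite gt_eqF.
pose F (u : R) := - ((u / x + x ^- 2) * expR (- (u * x))).
have -> : x ^- 2 = 0 - F 0.
  by rewrite /F !mul0r oppr0 expR0; ring.
apply: ge0_integral0y.
- by move=> u u0; rewrite mulr_ge0 ?expR_ge0.
- by move=> u; apply: is_derive_continuous.
- move=> u; rewrite /F; apply: is_derive_eq; rewrite /GRing.scale /=; field.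
  by rewrite xn0.
(* half of the exponential absorbs the linear factor, by [1 + v <= expR v] *)
have -> : F =
    (fun u => (- ((u / x + x ^- 2) * expR (- (u * (x / 2))))) * expR (- (u * (x / 2)))).
  apply/funext => u; rewrite /F mulNr -mulrA -expRD -opprD -mulrDr.
  by rewrite (_ : x / 2 + x / 2 = x)//; field.
apply: (@cvg_bounded_exp _ (3 / x ^+ 2)) => [|u u0]; first by rewrite divr_gt0.
rewrite normrN ger0_norm; last first.
  by rewrite mulr_ge0 ?expR_ge0// addr_ge0// ?divr_ge0// ?invr_ge0 ?exprn_ge0// ltW.
rewrite expRN ler_pdivrMr ?expR_gt0//.
have e1 : 1 + u * (x / 2) <= expR (u * (x / 2)) by exact: expR_ge1Dx.
have c0 : 0 <= 3 / x ^+ 2 by rewrite divr_ge0// exprn_ge0// ltW.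
apply: le_trans (ler_wpM2l c0 e1).
rewrite -subr_ge0 (_ : _ - _ = 2 / x ^+ 2 + u / x / 2); last by field.
by rewrite !(addr_ge0, divr_ge0)// ?exprn_ge0// ltW.
Unshelve. all: by end_near. Qed.

Lemma integral_laplace_cos (u s : R) : 0 < u ->
  (\int[leb]_(x in `[0%R, +oo[) ((1 - cos (x * s)) * u * expR (- (x * u)))%:E =
   (s ^+ 2 / (u ^+ 2 + s ^+ 2))%:E)%E.
Proof.
move=> u0; have un0 : u != 0 by rewrite gt_eqF.
have us0 : u ^+ 2 + s ^+ 2 != 0 by rewrite gt_eqF// ltr_pwDl ?exprn_gt0// sqr_ge0.
(* [F] below is the elementary antiderivative, from integrating
   [expR (- x u) * cos (x s)] by parts twice *)
pose a x := u * (u * cos (x * s) - s * sin (x * s)) / (u ^+ 2 + s ^+ 2) - 1.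
pose F (x : R) := a x * expR (- (x * u)).
have -> : s ^+ 2 / (u ^+ 2 + s ^+ 2) = 0 - F 0.
  rewrite /F /a !mul0r cos0 sin0 oppr0 expR0.
  by field.
apply: ge0_integral0y.
- move=> x x0; rewrite mulr_ge0 ?expR_ge0// mulr_ge0// ?(ltW u0)// subr_ge0 cos_le1.
- by move=> x; apply: is_derive_continuous.
- move=> x; rewrite /F /a; apply: is_derive_eq; rewrite /GRing.scale /=.
  by field.
apply: (@cvg_bounded_exp _ (u * (u + `|s|) / (u ^+ 2 + s ^+ 2) + 1)) => // x x0.
rewrite (le_trans (ler_normB _ _))// normr1 lerD2r.
have us1 : 0 <= (u ^+ 2 + s ^+ 2)^-1 by rewrite invr_ge0 addr_ge0 ?sqr_ge0.
rewrite normrM (ger0_norm us1) ler_wpM2r// normrM (gtr0_norm u0) ler_wpM2l ?(ltW u0)//.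
rewrite (le_trans (ler_normB _ _))// !normrM (gtr0_norm u0) lerD//.
  by rewrite ler_piMr ?(ltW u0)// ler_norml cos_geN1 cos_le1.
by rewrite ler_piMr// ler_norml sin_geN1 sin_le1.
Qed.

Lemma continuous_cauchy (s : R) : 0 < s ->
  continuous (fun u : R => s ^+ 2 / (u ^+ 2 + s ^+ 2)).
Proof.
move=> s0 u; apply: (@continuousM R R (cst (s ^+ 2)) (fun u : R => (u ^+ 2 + s ^+ 2)^-1) u).
  exact: cst_continuous.
apply: (@continuousV R R (fun u : R => u ^+ 2 + s ^+ 2) u).
  by rewrite gt_eqF// ltr_wpDl ?exprn_gt0// sqr_ge0.
exact: is_derive_continuous.
Qed.

Lemma integral_cauchy (s : R) : 0 < s ->
  (\int[leb]_(u in `[0%R, +oo[) (s ^+ 2 / (u ^+ 2 + s ^+ 2))%:E = (s * (pi / 2))%:E)%E.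
Proof.
move=> s0; have sn0 : s != 0 by rewrite gt_eqF.
have us0 u : u ^+ 2 + s ^+ 2 != 0 by rewrite gt_eqF// ltr_wpDl ?exprn_gt0// sqr_ge0.
pose F (u : R) := s * atan (u / s).
have -> : s * (pi / 2) = s * (pi / 2) - F 0 by rewrite /F mul0r atan0 mulr0 subr0.
apply: ge0_integral0y.
- by move=> u _; rewrite divr_ge0 ?addr_ge0 ?sqr_ge0.
- exact: continuous_cauchy.
- move=> u; rewrite /F; apply: is_derive_eq.
  rewrite /GRing.scale /=. field.
  by rewrite us0 sn0.
apply: cvgM; first exact: cvg_cst.
apply: (@cvg_comp _ _ _ (fun u : R => u / s) (@atan R) +oo +oo); last exact: cvgy_atan.
by apply: gt0_cvgMly; rewrite ?invr_gt0.
Qed.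

Lemma integral_indic_mul (P : set R) (f : R -> R) : measurable P ->
  (\int[leb]_x (\1_P x * f x)%:E = \int[leb]_(x in P) (f x)%:E)%E.
Proof.
move=> mP; rewrite [RHS]integral_mkcond; apply: eq_integral => x _.
by rewrite /patch indicE; case: ifPn => xP; rewrite ?mul1r ?mul0r.
Qed.

(** Since [x ^- 2] is the Laplace transform of the identity, Tonelli's theorem
    turns the integral of [(1 - cos (x s)) / x ^ 2] into that of a Cauchy
    density, which is an arctangent. *)
Lemma integral0y_fejer (s : R) : 0 < s ->
  (\int[leb]_(x in `[0%R, +oo[) (s ^+ 2 / 2 * fejer s x)%:E = (s * (pi / 2))%:E)%E.
Proof.
move=> s0; pose P := (`]0%R, +oo[ : set R)%classic.
have mP : measurable P by exact: measurable_itv.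
have mf : measurable_fun setT (fun x : R => s ^+ 2 / 2 * fejer s x).
  apply: measurable_funM; first exact: measurable_cst.
  by apply: continuous_measurable_fun; exact: fejer_continuous.
rewrite -integral_itv_obnd_cbnd; last exact/measurable_EFinP/measurable_funTS.
pose h (z : measurableTypeR R * measurableTypeR R) : R := (\1_P z.1 * \1_P z.2) *
  ((1 - cos (z.1 * s)) * z.2 * expR (- (z.1 * z.2))).
have m1 : measurable_fun setT (fun z : measurableTypeR R * measurableTypeR R => z.1).
  exact: measurable_fst.
have m2 : measurable_fun setT (fun z : measurableTypeR R * measurableTypeR R => z.2).
  exact: measurable_snd.
have mh : measurable_fun setT (EFin \o h).
  apply/measurable_EFinP; apply: measurable_funM.
    by apply: measurable_funM; apply: measurableT_comp => //; exact: measurable_indic.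
  apply: measurable_funM; last first.
    by apply: measurableT_comp => //; apply: measurableT_comp => //; exact: measurable_funM.
  apply: measurable_funM => //; apply: measurable_funB; first exact: measurable_cst.
  apply: measurableT_comp; first by apply: continuous_measurable_fun; exact: continuous_cos.
  by apply: measurable_funM => //; exact: measurable_cst.
have h0 z : (0 <= (h z)%:E)%E.
  rewrite lee_fin /h !indicE.
  have [z1|] := boolP (z.1 \in P); last by rewrite !mul0r.
  have [z2|] := boolP (z.2 \in P); last by rewrite mulr0 mul0r.
  rewrite !mul1r mulr_ge0 ?expR_ge0// mulr_ge0// ?subr_ge0 ?cos_le1//.
  by move: z2; rewrite inE /P /= in_itv /= andbT => /ltW.
have Iu (x : R) : x \in P -> (\int[leb]_u (h (x, u))%:E = (s ^+ 2 / 2 * fejer s x)%:E)%E.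
  move=> xP; have x0 : 0 < x by move: xP; rewrite inE /P /= in_itv /= andbT.
  rewrite fejer_cos ?gt_eqF// EFinM -(integral_laplace_id x0).
  rewrite -integral_itv_obnd_cbnd; last first.
    apply/measurable_EFinP/measurable_funTS; apply: continuous_measurable_fun => u.
    exact: is_derive_continuous.
  rewrite -(integral_indic_mul (fun u => u * expR (- (u * x))) mP).
  rewrite -ge0_integralZl_EFin ?subr_ge0 ?cos_le1//; last 2 first.
  - move=> u _; rewrite lee_fin indicE; have [uP|] := boolP (u \in P); last by rewrite mul0r.
    rewrite mul1r mulr_ge0 ?expR_ge0//.
    by move: uP; rewrite inE /P /= in_itv /= andbT => /ltW.
  - apply/measurable_EFinP/measurable_funM; first exact: measurable_indic.
    by apply: continuous_measurable_fun => u; exact: is_derive_continuous.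
  apply: eq_integral => u _; rewrite /h /= (indicE _ P x) xP mul1r -EFinM (mulrC u x); congr EFin.
  by rewrite [RHS]mulrCA -!mulrA.
have Ix (u : R) : u \in P -> (\int[leb]_x (h (x, u))%:E =
    (s ^+ 2 / (u ^+ 2 + s ^+ 2))%:E)%E.
  move=> uP; have u0 : 0 < u by move: uP; rewrite inE /P /= in_itv /= andbT.
  rewrite -integral_laplace_cos// -integral_itv_obnd_cbnd; last first.
    apply/measurable_EFinP/measurable_funTS; apply: continuous_measurable_fun => x.
    exact: is_derive_continuous.
  rewrite -[RHS]integral_indic_mul//; apply: eq_integral => x _.
  by rewrite /h /= !indicE uP mulr1.
transitivity (\int[leb]_x \int[leb]_u (h (x, u))%:E)%E.
  rewrite -[LHS]integral_indic_mul//; apply: eq_integral => x _; rewrite indicE.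
  have [xP|xP] := boolP (x \in P); first by rewrite mul1r Iu.
  rewrite mul0r integral0_eq// => u _.
  by rewrite /h /= indicE (negPf xP) !mul0r.
transitivity (\int[leb]_u \int[leb]_x (h (x, u))%:E)%E.
  exact: (@fubini_tonelli _ _ _ _ _ leb leb (EFin \o h) mh h0).
transitivity (\int[leb]_(u in P) (s ^+ 2 / (u ^+ 2 + s ^+ 2))%:E)%E.
  rewrite -[RHS]integral_indic_mul//; apply: eq_integral => u _; rewrite [in RHS]indicE.
  have [uP|uP] := boolP (u \in P); first by rewrite mul1r Ix.
  rewrite mul0r integral0_eq// => x _.
  by rewrite /h /= (indicE _ P u) (negPf uP) mulr0 mul0r.
rewrite integral_itv_obnd_cbnd; first exact: integral_cauchy.
apply/measurable_EFinP/measurable_funTS; apply: continuous_measurable_fun.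
exact: continuous_cauchy.
Qed.

End FejerIntegral.

Section FejerFourier.
Context {R : realType}.
Local Notation leb := (@lebesgue_measure R).
Implicit Types d s x y : R.

Lemma integralT_fejer s : (\int[leb]_x (s ^+ 2 / 2 * fejer s x)%:E = (pi * `|s|)%:E)%E.
Proof.
wlog s0 : s / 0 < s => [H|].
  have [s0|//|->] := ltgtP s 0; last 2 first.
  - exact: H.
  - by rewrite normr0 mulr0 integral0_eq// => x _; rewrite expr0n !mul0r.
  have := H (- s); rewrite oppr_gt0 => /(_ s0); rewrite normrN => <-.
  by under [in RHS]eq_integral do rewrite fejerNl sqrrN.
have cf : continuous (fun x => s ^+ 2 / 2 * fejer s x).
  by move=> x; apply: (@continuousM R R (cst _) (fejer s));
    [exact: cst_continuous|exact: fejer_continuous].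
have f0 x : 0 <= s ^+ 2 / 2 * fejer s x by rewrite mulr_ge0 ?fejer_ge0// divr_ge0// sqr_ge0.
rewrite ge0_integralT_fold//.
under [X in (_ + X)%E]eq_integral do rewrite fejerNr.
by rewrite integral0y_fejer// -EFinD gtr0_norm//; congr EFin; field.
Qed.

Lemma measurable_fejer s : measurable_fun setT (fejer s).
Proof. by apply: continuous_measurable_fun; exact: fejer_continuous. Qed.

Lemma rintegrable_sqr_fejer s : rintegrable leb (fun x => s ^+ 2 / 2 * fejer s x).
Proof.
apply/integrableP; split.
  by apply/measurable_EFinP/measurable_funM; [exact: measurable_cst|exact: measurable_fejer].
have f0 x : 0 <= s ^+ 2 / 2 * fejer s x by rewrite mulr_ge0 ?fejer_ge0// divr_ge0// sqr_ge0.
under eq_integral do rewrite /= ger0_norm//.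
by rewrite integralT_fejer ltry.
Qed.

Lemma rintegrable_fejer s : s != 0 -> rintegrable leb (fejer s).
Proof.
move=> s0; have := rintegrableZ (2 / s ^+ 2) (rintegrable_sqr_fejer s).
congr rintegrable; apply/funext => x.
by field.
Qed.

Lemma rintegrable_fejerM s (f : R -> R) : s != 0 -> measurable_fun setT f ->
  (forall x, `|f x| <= 1) -> rintegrable leb (fun x => fejer s x * f x).
Proof.
move=> s0 mf f1; apply: le_rintegrable (rintegrable_fejer s0).
  by apply: measurable_funM => //; exact: measurable_fejer.
by move=> x; rewrite normrM (ger0_norm (fejer_ge0 _ _)) ler_piMr ?fejer_ge0.
Qed.

Lemma measurable_cosM s : measurable_fun setT (fun x : R => cos (x * s)).
Proof. by apply: continuous_measurable_fun => x; exact: is_derive_continuous. Qed.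

Lemma measurable_sinM s : measurable_fun setT (fun x : R => sin (x * s)).
Proof. by apply: continuous_measurable_fun => x; exact: is_derive_continuous. Qed.

Lemma cos_norm_le1 x : `|cos x| <= 1.
Proof. by rewrite ler_norml cos_geN1 cos_le1. Qed.

Lemma sin_norm_le1 x : `|sin x| <= 1.
Proof. by rewrite ler_norml sin_geN1 sin_le1. Qed.

(** The triangle of height [d^-1] over [[-d, d]], in the form in which
    polarization of [pi * `|s|] produces it. *)
Definition tent d s : R := (`|s + d| + `|s - d| - `|s| *+ 2) / (d ^+ 2 *+ 2).

Lemma integral_fejer_cos d s : d != 0 ->
  \int[leb]_x (fejer d x * cos (x * s)) = 2 * pi * tent d s.
Proof.
move=> d0; have d2 : d ^+ 2 != 0 by rewrite expf_neq0.
apply: (mulfI d2); rewrite -RintegralZl//; last first.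
  by apply: rintegrable_fejerM => //; [exact: measurable_cosM|move=> x; exact: cos_norm_le1].
under eq_Rintegral do rewrite fejer_polarize.
have I k := rintegrable_sqr_fejer k.
have I2 : rintegrable leb (fun x => s ^+ 2 * fejer s x).
  have := rintegrableZ 2 (I s); congr rintegrable; apply/funext => x; by field.
rewrite RintegralB//; last exact: rintegrableD.
rewrite RintegralD//; [|exact: I|exact: I].
rewrite {1 2}/Rintegral !integralT_fejer /=.
have -> : \int[leb]_x (s ^+ 2 * fejer s x) = 2 * (pi * `|s|).
  rewrite -[pi * `|s|]/(fine (pi * `|s|)%:E) -integralT_fejer -/(Rintegral _ _ _).
  rewrite -RintegralZl//; last exact: I.
  by apply: eq_Rintegral => x _; field.
by rewrite /tent; field; rewrite d0.
Qed.

(** The integrand is odd. Adding the kernel makes it nonnegative, so that the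
    reflection [x -> - x] can be applied without splitting it into parts. *)
Lemma integral_fejer_sin d s : d != 0 -> \int[leb]_x (fejer d x * sin (x * s)) = 0.
Proof.
move=> d0; pose f x := fejer d x * (1 + sin (x * s)).
have cs : continuous (fun x => 1 + sin (x * s)).
  by move=> x; exact: is_derive_continuous.
have f0 x : 0 <= f x.
  by rewrite mulr_ge0 ?fejer_ge0// -lerBlDl sub0r sin_geN1.
have cf : continuous f.
  by move=> x; apply: (@continuousM R R (fejer d) _ x); [exact: fejer_continuous|exact: cs].
have I1 := rintegrable_fejer d0.
have I2 : rintegrable leb (fun x => fejer d x * sin (x * s)).
  by apply: rintegrable_fejerM => //; [exact: measurable_sinM|move=> x; exact: sin_norm_le1].
have := congr1 fine (ge0_integralT_opp f0 cf).
have -> : fine (\int[leb]_x (f (- x))%:E) =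
    \int[leb]_x fejer d x - \int[leb]_x (fejer d x * sin (x * s)).
  rewrite -RintegralB//; apply: eq_Rintegral => x _.
  by rewrite /f fejerNr mulNr sinN; ring.
have -> : fine (\int[leb]_x (f x)%:E) =
    \int[leb]_x fejer d x + \int[leb]_x (fejer d x * sin (x * s)).
  rewrite -RintegralD//; apply: eq_Rintegral => x _.
  by rewrite /f; ring.
by lra.
Qed.

Lemma tent_ge0 d s : 0 <= tent d s.
Proof.
rewrite divr_ge0 ?mulrn_wge0 ?sqr_ge0// subr_ge0 -normrMn.
rewrite (le_trans _ (ler_normD _ _))//.
by rewrite (_ : s + d + (s - d) = s *+ 2)//; ring.
Qed.

Lemma tent_eq0 d s : 0 < d -> d <= `|s| -> tent d s = 0.
Proof.
move=> d0; rewrite /tent; have [s0|s0] := leP 0 s.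
  rewrite (ger0_norm s0) => ds; rewrite !ger0_norm; [|lra..].
  by rewrite (_ : _ - _ = 0) ?mul0r//; ring.
rewrite (ltr0_norm s0) => ds; rewrite !ler0_norm; [|lra..].
by rewrite (_ : _ - _ = 0) ?mul0r//; ring.
Qed.

Lemma tent_continuous d : continuous (tent d).
Proof.
move=> s; have cn : {for s, continuous (fun s : R => `|s|)} by exact: norm_continuous.
have cnD (k : R) : {for s, continuous (fun s : R => `|s + k|)}.
  apply: (@continuous_comp _ _ _ (fun s : R => s + k) Num.norm).
    exact: is_derive_continuous.
  exact: norm_continuous.
apply: (@continuousM R R (fun s : R => `|s + d| + `|s - d| - `|s| *+ 2) (cst _) s);
  last exact: cst_continuous.
apply: (@continuousB _ _ _ (fun s : R => `|s + d| + `|s - d|) (fun s : R => `|s| *+ 2)).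
  by apply: (@continuousD _ _ _ (fun s : R => `|s + d|)); exact: cnD.
by apply: (@continuousD _ _ _ (fun s : R => `|s|) (fun s : R => `|s|)).
Qed.

Lemma is_derive_xnormx (x : R) : is_derive x (1 : R) (fun x : R => x * `|x| / 2) `|x|.
Proof.
suff H : h^-1 *: ((h + x) * `|h + x| / 2 - x * `|x| / 2) @[h --> 0^'] --> `|x|.
  have H' : h^-1 *: (((fun x : R => x * `|x| / 2) \o shift x) (h *: 1) - x * `|x| / 2)
      @[h --> 0^'] --> `|x|.
    by under eq_fun do rewrite /= /GRing.scale /= mulr1.
  by apply: DeriveDef; [apply/cvg_ex; exists `|x| |exact: cvg_lim H'].
(* the difference quotient lies within [`|h|] of [`|x|] *)
apply/cvgrPdist_le => e e0; near=> h.
have h0 : h != 0 by near: h; exact: nbhs_dnbhs_neq.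
have he : `|h| <= e by near: h; exact: dnbhs0_le.
apply: le_trans he.
rewrite -(ler_pM2l (_ : 0 < `|h|)) ?normr_gt0// -normrM mulrBr mulVKf//.
rewrite -expr2 -normrX (ger0_norm (sqr_ge0 h)) ler_norml.
have [x0|x0] := leP 0 x; have [hx0|hx0] := leP 0 (h + x).
- by rewrite (ger0_norm x0) (ger0_norm hx0); apply/andP; split; nra.
- by rewrite (ger0_norm x0) (ltr0_norm hx0); apply/andP; split; nra.
- by rewrite (ltr0_norm x0) (ger0_norm hx0); apply/andP; split; nra.
- by rewrite (ltr0_norm x0) (ltr0_norm hx0); apply/andP; split; nra.
Unshelve. all: by end_near. Qed.

Lemma integral_tent d y : 0 < d -> (\int[leb]_x (tent d (x - y))%:E = 1)%E.
Proof.
move=> d0; have dn0 : d != 0 by rewrite gt_eqF.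
pose A (x : R) := x * `|x| / 2.
have dA (k x : R) : is_derive x (1 : R) (fun x => A (x - y + k)) `|x - y + k|.
  have dk : is_derive x (1 : R) (fun x => x - y + k) 1.
    by apply: is_derive_eq; rewrite subr0 addr0.
  have := @is_derive1_comp _ A (fun x => x - y + k) x _ _ (is_derive_xnormx _) dk.
  by rewrite mulr1.
(* the same second difference of an antiderivative of the absolute value: it is
   constant, equal to 1/2 or - 1/2, beyond the support *)
pose F x := (A (x - y + d) + A (x - y + - d) - (A (x - y + 0)) *+ 2) / (d ^+ 2 *+ 2).
rewrite (_ : 1 = (1/2 - (- (1/2)))%:E)%E; last by congr EFin; field.
have ct : continuous (fun x : R => tent d (x - y)).
  move=> x; apply: (@continuous_comp _ _ _ (fun x : R => x - y) (tent d) x).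
    exact: is_derive_continuous.
  exact: (@tent_continuous d (x - y)).
apply: (@ge0_integralT_FTC _ _ F).
- by move=> x; exact: tent_ge0.
- exact: ct.
- move=> x; have d1 := dA d x; have d2 := dA (- d) x; have d3 := dA 0 x.
  by apply: is_derive_eq; rewrite /tent /GRing.scale /= addr0; field; rewrite dn0.
- apply: (@cvg_near_cst _ _ _ F (pinfty_nbhs R)); near=> x.
  have xy : d <= x - y by rewrite lerBrDr; near: x; apply: nbhs_pinfty_ge; exact: num_real.
  rewrite /F /A !ger0_norm; [|lra..]; by field.
- apply: (@cvg_near_cst _ _ _ F (ninfty_nbhs R)); near=> x.
  have xy : x - y <= - d by rewrite lerBlDr; near: x; apply: nbhs_ninfty_le; exact: num_real.
  rewrite /F /A !ler0_norm; [|lra..]; by field.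
Unshelve. all: by end_near. Qed.

End FejerFourier.

(** * Integrals of product functions *)

Section ProductFunctions.
Context {d1 d2} {T1 : measurableType d1} {T2 : measurableType d2} {R : realType}.
Variables (m1 : {sigma_finite_measure set T1 -> \bar R}).
Variables (m2 : {sigma_finite_measure set T2 -> \bar R}).
Local Notation m12 := (m1 \x m2)%E.

Lemma measurable_prodM (a : T1 -> R) (b : T2 -> R) :
  measurable_fun setT a -> measurable_fun setT b ->
  measurable_fun setT (fun z : T1 * T2 => a z.1 * b z.2).
Proof.
by move=> ma mb; apply: measurable_funM; apply: measurableT_comp.
Qed.

Lemma rintegrable_prodM (a : T1 -> R) (b : T2 -> R) :
  rintegrable m1 a -> rintegrable m2 b ->
  rintegrable m12 (fun z : T1 * T2 => a z.1 * b z.2).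
Proof.
move=> ia ib; have ma := rintegrable_meas ia; have mb := rintegrable_meas ib.
apply/integrable12ltyP; first by apply/measurable_EFinP; exact: measurable_prodM.
have nb : (\int[m2]_y (`|b y|)%:E = (\int[m2]_y `|b y|)%:E)%E.
  by rewrite fineK//; exact: (integrable_fin_num measurableT (rintegrable_norm ib)).
under eq_integral => x _.
  under eq_integral do rewrite /= normrM EFinM.
  rewrite ge0_integralZl_EFin ?nb//; last first.
    by apply/measurable_EFinP; exact: measurableT_comp.
  over.
have := rintegrableZ (\int[m2]_y `|b y|) (rintegrable_norm ia).
move=> /integrableP[_]; apply: le_lt_trans; apply: ge0_le_integral => //.
- by move=> x _; rewrite mule_ge0 ?lee_fin// Rintegral_ge0.
- apply/measurable_EFinP; apply: measurable_funM; last exact: measurable_cst.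
  exact: measurableT_comp.
- apply/measurable_EFinP; apply: measurableT_comp => //.
  apply: measurable_funM; first exact: measurable_cst.
  exact: measurableT_comp.
- by move=> x _; rewrite -EFinM lee_fin mulrC ler_norm.
Qed.

Lemma Rintegral_prodM (a : T1 -> R) (b : T2 -> R) :
  rintegrable m1 a -> rintegrable m2 b ->
  \int[m12]_z (a z.1 * b z.2) = (\int[m1]_x a x) * (\int[m2]_y b y).
Proof.
move=> ia ib; rewrite {1}/Rintegral -(integral12_prod_meas1 (rintegrable_prodM ia ib)).
under eq_integral => x _.
  rewrite /fubini_F /=.
  have -> : (\int[m2]_y (a x * b y)%:E = (a x * \int[m2]_y b y)%:E)%E.
    rewrite -RintegralZl// fineK//.
    exact: (integrable_fin_num measurableT (rintegrableZ (a x) ib)).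
  over.
exact: RintegralZr.
Qed.

End ProductFunctions.

Section LebesgueProduct.
Context {R : realType}.
Local Notation leb := (@lebesgue_measure R).
Local Notation point n := (n.-tuple (measurableTypeR R)).

(** By induction, the measure in dimension [n + 1] being the image under consing
    of a product measure, from which Fubini's theorem splits off the first
    factor. *)
Lemma lebesgueRn_prod (n : nat) (h : 'I_n -> R -> R) :
  (forall i, rintegrable leb (h i)) ->
  rintegrable (lebesgueRn R n) (fun t : point n => \prod_(i < n) h i (tnth t i)) /\
  \int[lebesgueRn R n]_t (\prod_(i < n) h i (tnth t i)) =
    \prod_(i < n) \int[leb]_x h i x.
Proof.
elim: n h => [|n IH] h hi.
  have pE : (fun t : point 0 => \prod_(i < 0) h i (tnth t i)) = cst 1.
    by apply/funext => t; rewrite big_ord0.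
  rewrite pE big_ord0; split; first exact: finite_measure_integrable_cst.
  rewrite /Rintegral integral_dirac//; last exact: (measurable_cst (1%:E)).
  by rewrite diracT mul1e.
have [ip Ip] := IH (fun i => h (lift ord0 i)) (fun i => hi _).
pose p (t : point n) := \prod_(i < n) h (lift ord0 i) (tnth t i).
pose P (t : point n.+1) := \prod_(i < n.+1) h i (tnth t i).
have mP : measurable_fun setT (EFin \o P).
  apply/measurable_EFinP; apply: measurable_prod => i _.
  apply: (@measurableT_comp _ _ _ _ _ _ (h i)); last exact: measurable_tnth.
  exact: rintegrable_meas (hi i).
have PE : P \o @tcons R n = fun z => h ord0 z.1 * p z.2.
  apply/funext => z; rewrite /P /= big_ord_recl; congr (_ * _).
  by apply: eq_bigr => i _; rewrite tnthS.
have iz : rintegrable (leb \x lebesgueRn R n)%E (P \o @tcons R n).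
  by rewrite PE; exact: rintegrable_prodM.
split.
  exact: (integrable_pushforward (@measurable_tcons R n) mP iz measurableT).
rewrite big_ord_recl -Ip -Rintegral_prodM//.
rewrite {1}/Rintegral; congr fine.
have := integral_pushforward (@measurable_tcons R n) mP iz measurableT.
rewrite preimage_setT => ->.
by apply: eq_integral => z _; rewrite -[X in X%:E]/((fun z => h ord0 z.1 * p z.2) z) -PE.
Qed.

End LebesgueProduct.

(** * Fourier inversion *)

Section CliffordFubini.
Context {d1 d2} {T1 : measurableType d1} {T2 : measurableType d2} {R : realType} {m : nat}.
Variables (m1 : {sigma_finite_measure set T1 -> \bar R}).
Variables (m2 : {sigma_finite_measure set T2 -> \bar R}).

(** Asking all sections to be integrable, and not just almost all, makes the
    inner integrals finite everywhere, so that they may be taken in the reals. *)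
Lemma clint_fubini (K : T1 * T2 -> clifford R m) :
  clintegrable (m1 \x m2)%E K ->
  (forall x, clintegrable m2 (fun y => K (x, y))) ->
  (forall y, clintegrable m1 (fun x => K (x, y))) ->
  clint m1 (fun x => clint m2 (fun y => K (x, y))) =
  clint m2 (fun y => clint m1 (fun x => K (x, y))).
Proof.
move=> iK iK2 iK1; apply: cliffordP => I; rewrite !coef_clint /Rintegral; congr fine.
under eq_integral => x _.
  rewrite coef_clint fineK; last exact: (integrable_fin_num measurableT (iK2 x I)).
  over.
under [RHS]eq_integral => y _.
  rewrite coef_clint fineK; last exact: (integrable_fin_num measurableT (iK1 y I)).
  over.
exact: (Fubini (iK I)).
Qed.

End CliffordFubini.

Section NormalizedMeasure.
Context {R : realType} {n : nat}.
Local Notation lam := (lebesgueRn R n).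
Local Notation point := (n.-tuple (measurableTypeR R)).

Definition dm_const : R := (2 * pi) `^ (- (n%:R / 2)).

Lemma dm_const_gt0 : 0 < dm_const.
Proof. by rewrite powR_gt0// mulr_gt0// pi_gt0. Qed.

Lemma dm_const_sqr : dm_const ^+ 2 * (2 * pi) ^+ n = 1.
Proof.
have p0 : 0 < 2 * pi :> R by rewrite mulr_gt0// pi_gt0.
rewrite expr2 /dm_const -powRD; last by rewrite (gt_eqF p0) implybT.
rewrite -opprD -splitr powRN powR_mulrn ?ltW// mulVf//.
by rewrite expf_neq0// gt_eqF.
Qed.

Lemma ge0_integral_dm (f : point -> R) : measurable_fun setT f -> (forall t, 0 <= f t) ->
  (\int[dm R n]_t (f t)%:E = dm_const%:E * \int[lam]_t (f t)%:E)%E.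
Proof.
move=> mf f0; apply: (ge0_integral_mscale _ _ _ _ (f := EFin \o f)) => //.
- exact/measurable_EFinP.
- by move=> t _; rewrite lee_fin.
Qed.

Lemma rintegrable_dm (f : point -> R) : rintegrable (dm R n) f <-> rintegrable lam f.
Proof.
have c0 := dm_const_gt0.
split=> /[dup] /rintegrable_meas mf /integrableP[_ foo]; apply/integrableP;
  (split; first exact/measurable_EFinP); move: foo => /=;
  rewrite (ge0_integral_dm (f := fun t => `|f t|))//; try exact: measurableT_comp.
  case: (\int[lam]_t _)%E => [r _|/=|_]; [exact: ltry| |by []].
  by rewrite mulry gtr0_sg// mul1e.
by move=> foo; rewrite lte_mul_pinfty// lee_fin ltW.
Qed.

Lemma Rintegral_dm (f : point -> R) : rintegrable lam f ->
  \int[dm R n]_t f t = dm_const * \int[lam]_t f t.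
Proof.
move=> fi; have mf := rintegrable_meas fi.
have fpi := rintegrable_norm fi.
(* split [f] as the difference of the nonnegative functions |f| and |f| - f *)
pose p t := `|f t|; pose q t := `|f t| - f t.
have q0 t : 0 <= q t by rewrite subr_ge0 ler_norm.
have qi : rintegrable lam q.
  have := rintegrableD fpi (rintegrableZ (-1) fi); congr rintegrable.
  by apply/funext => t; rewrite /q mulN1r.
have fE : f = fun t => p t - q t by apply/funext => t; rewrite /p /q subKr.
have mp := rintegrable_meas fpi; have mq := rintegrable_meas qi.
have E (h : point -> R) : measurable_fun setT h -> (forall t, 0 <= h t) -> rintegrable lam h ->
    \int[dm R n]_t h t = dm_const * \int[lam]_t h t.
  move=> mh h0 hi; rewrite /Rintegral ge0_integral_dm// fineM//.
  exact: (integrable_fin_num measurableT hi).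
have -> : \int[lam]_t f t = \int[lam]_t p t - \int[lam]_t q t.
  by rewrite -RintegralB//; congr Rintegral.
have -> : \int[dm R n]_t f t = \int[dm R n]_t p t - \int[dm R n]_t q t.
  rewrite -RintegralB//; first by congr Rintegral.
    by have /rintegrable_dm := fpi.
  by have /rintegrable_dm := qi.
have p0 t : 0 <= p t by exact: normr_ge0.
by rewrite !E// mulrBr.
Qed.

Lemma clint_dm (F : point -> clifford R (n + n)) : clintegrable lam F ->
  clint (dm R n) F = dm_const *: clint lam F.
Proof.
move=> Fi; apply: cliffordP => I; rewrite Defs.coefZ !coef_clint.
exact: Rintegral_dm (Fi I).
Qed.

Lemma clintegrable_dm (F : point -> clifford R (n + n)) :
  clintegrable (dm R n) F <-> clintegrable lam F.
Proof. by split=> Fi I; apply/rintegrable_dm; exact: Fi. Qed.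

End NormalizedMeasure.

Section Inversion.
Context {R : realType} {n : nat}.
Local Notation G2n := (clifford R (n + n)).
Local Notation X := (@rV_of_tuple R n).
Local Notation lam := (lebesgueRn R n).
Local Notation leb := (@lebesgue_measure R).
Local Notation point := (n.-tuple (measurableTypeR R)).
Implicit Types (x y s : 'rV[R]_n) (d : R).

Definition fejern d x : R := \prod_(i < n) fejer d (x 0 i).

Definition tentn d s : R := \prod_(i < n) tent d (s 0 i).

Lemma fejern_ge0 d x : 0 <= fejern d x.
Proof. by apply: prodr_ge0 => i _; exact: fejer_ge0. Qed.

Lemma fejern_le1 d x : fejern d x <= 1.
Proof.
rewrite -[leRHS](@big1_eq _ _ (@GRing.mul R) _ (index_enum 'I_n) predT); apply: ler_prod => i _.
by rewrite fejer_ge0 fejer_le1.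
Qed.

Lemma rintegrable_fejern d : d != 0 -> rintegrable lam (fun t => fejern d (X t)).
Proof.
move=> d0; have [+ _] := @lebesgueRn_prod R n (fun _ => fejer d) (fun _ => rintegrable_fejer d0).
by congr rintegrable; apply/funext => t; apply: eq_bigr => i _; rewrite mxE.
Qed.

Lemma meas_fejern {disp : measure_display} {T : measurableType disp}
    (u : T -> 'rV[R]_n) d : rvmeas u ->
  measurable_fun setT (fun t => fejern d (u t)).
Proof.
move=> mu; apply: measurable_prod => i _; apply: measurableT_comp; last exact: mu.
exact: measurable_fejer.
Qed.

(** Expanding the product over the coordinates into monomials in the [B_i],
    the integral factors into one-dimensional Fourier integrals, of which the
    sine parts vanish by symmetry. *)
Lemma fejern_fourier d s : d != 0 ->
  clint lam (fun t => fejern d (X t) *: cis (X t) s) =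
  ((2 * pi) ^+ n * tentn d s)%:A.
Proof.
move=> d0.
pose w i (b : bool) (x : R) :=
  fejer d x * (if b then sin (x * s 0 i) else cos (x * s 0 i)).
pose M (i : 'I_n) (b : bool) : G2n := if b then bivec R i else 1.
have wi i b : rintegrable leb (w i b).
  apply: rintegrable_fejerM => // [|x].
    by case: b; [exact: measurable_sinM|exact: measurable_cosM].
  by case: b; [exact: sin_norm_le1|exact: cos_norm_le1].
have E t : fejern d (X t) *: cis (X t) s = \sum_(phi : {ffun 'I_n -> bool})
    (\prod_(i < n) w i (phi i) (tnth t i)) *: \prod_(i < n) M i (phi i).
  rewrite /fejern /cis -scaler_prod.
  under eq_bigr => i _.
    have -> : fejer d (X t 0 i) *: ((cos (X t 0 i * s 0 i))%:A +
        sin (X t 0 i * s 0 i) *: bivec R i) = \sum_b w i b (tnth t i) *: M i b.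
      by rewrite big_bool /w /M /= mxE scalerDr !scalerA addrC.
    over.
  rewrite bigA_distr_bigA; apply: eq_bigr => phi _.
  by rewrite -scaler_prod.
under eq_fun do rewrite E.
have wip (phi : {ffun 'I_n -> bool}) := lebesgueRn_prod (fun i => wi i (phi i)).
rewrite clint_sum => [|phi]; last by apply: clintegrableZ; exact: (wip phi).1.
under eq_bigr => phi _.
  rewrite clintZ; last exact: (wip phi).1.
  rewrite (wip phi).2 -scaler_prod; over.
rewrite -(bigA_distr_bigA (fun i b => (\int[leb]_x w i b x) *: M i b)) /=.
under eq_bigr => i _.
  rewrite big_bool /= {1}/w integral_fejer_sin// scale0r add0r.
  rewrite /w integral_fejer_cos// /M; over.
rewrite scaler_prod big_split /= prodr_const card_ord.
by rewrite big1_eq.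
Qed.

Lemma tentn_ge0 d s : 0 <= tentn d s.
Proof. by apply: prodr_ge0 => i _; exact: tent_ge0. Qed.

Lemma tentn_integral d y : 0 < d ->
  rintegrable lam (fun t : point => tentn d (X t - y)) /\
  \int[lam]_t tentn d (X t - y) = 1.
Proof.
move=> d0; have It i : (\int[leb]_z (tent d (z - y 0 i))%:E = 1)%E by exact: integral_tent.
have mt i : measurable_fun setT (fun x : R => tent d (x - y 0 i)).
  apply: measurableT_comp; first by apply: continuous_measurable_fun; exact: tent_continuous.
  by apply: continuous_measurable_fun => z; exact: is_derive_continuous.
have ti i : rintegrable leb (fun z : R => tent d (z - y 0 i)).
  apply/integrableP; split; first by apply/measurable_EFinP; exact: mt.
  under eq_integral do rewrite /= ger0_norm ?tent_ge0//.
  by rewrite It ltry.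
have tE : (fun t => tentn d (X t - y)) =
    (fun t => \prod_(i < n) (fun z : R => tent d (z - y 0 i)) (tnth t i)).
  by apply/funext => t; apply: eq_bigr => i _; rewrite !mxE.
have [] := lebesgueRn_prod ti; rewrite -tE => tni ->; split => //.
by rewrite big1// => i _; rewrite /Rintegral It.
Qed.

Lemma tentn_eq0 d s i : 0 < d -> d <= `|s 0 i| -> tentn d s = 0.
Proof. by move=> d0 ds; rewrite /tentn (bigD1 i) //= tent_eq0// mul0r. Qed.

(** The tent kernel is an approximate identity with shrinking compact
    support, so that continuity at the point suffices. *)
Lemma tentn_approx (f : 'rV[R]_n -> G2n) y (d : nat -> R) :
  {for y, continuous f} -> clmeas (fun t : point => f (X t)) ->
  (forall k, 0 < d k) -> d k @[k --> \oo] --> 0 ->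
  clint lam (fun t => tentn (d k) (X t - y) *: f (X t)) @[k --> \oo] --> f y.
Proof.
move=> cf mf d0 dk0; apply/cvg_coefP => I; apply/cvgrPdist_le => e e0.
have cfI : coef (f x) I @[x --> y] --> coef (f y) I.
  exact: (@continuous_cvg _ _ _ (nbhs y) (nbhs_filter y) f (fun A : G2n => coef A I)
    (f y) (@coef_continuous _ _ I _) cf).
have /nbhs_ballP[r /= r0 yr] : nbhs y [set x | `|coef (f y) I - coef (f x) I| <= e].
  by move/(@cvgrPdist_le _ _ _ _ (nbhs_filter y)): cfI; exact.
near=> k.
have dr : d k <= r.
  near: k; have /cvgrPdist_le/(_ r r0) := dk0.
  by apply: filterS => k; rewrite sub0r normrN ger0_norm// ltW.
have [ti t1] := tentn_integral y (d0 k).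
pose h t := tentn (d k) (X t - y) * (coef (f (X t)) I - coef (f y) I).
(* within the support of the tent [f] is close to [f y], elsewhere the tent vanishes *)
have he t : `|h t| <= e * tentn (d k) (X t - y).
  rewrite normrM (ger0_norm (tentn_ge0 _ _)) mulrC.
  have [near_y|/existsNP[i /negP]] := pselect (forall i, `|(X t - y) 0 i| < d k).
    rewrite ler_wpM2r ?tentn_ge0// distrC; apply: yr; split=> // i j.
    rewrite (ord1 i) /ball /= -opprB normrN (lt_le_trans _ dr)//.
    by have := near_y j; rewrite !mxE.
  by rewrite -leNgt => /(tentn_eq0 (d0 k)) ->; rewrite !mulr0.
have mh : measurable_fun setT h.
  apply: measurable_funM; first exact: rintegrable_meas ti.
  by apply: measurable_funB; [exact: mf|exact: measurable_cst].
have hi : rintegrable lam h by apply: le_rintegrable mh he (rintegrableZ e ti).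
rewrite coef_clint.
have -> : \int[lam]_t coef (tentn (d k) (X t - y) *: f (X t)) I =
    \int[lam]_t h t + coef (f y) I.
  rewrite -[X in _ + X]mul1r -t1 -RintegralZr// -RintegralD//; last first.
    by under eq_fun do rewrite mulrC; exact: rintegrableZ.
  by apply: eq_Rintegral => t _; rewrite Defs.coefZ /h; ring.
rewrite (_ : _ - (_ + _) = - \int[lam]_t h t); last by ring.
rewrite normrN (le_trans (le_normr_Rintegral measurableT hi))//.
rewrite -[e]mulr1 -t1 -RintegralZl//.
apply: le_Rintegral => //; first exact: rintegrable_norm.
exact: rintegrableZ.
Unshelve. all: by end_near. Qed.

End Inversion.

Section InversionTheorem.
Context {R : realType} {n : nat}.
Local Notation G2n := (clifford R (n + n)).
Local Notation X := (@rV_of_tuple R n).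
Local Notation lam := (lebesgueRn R n).
Local Notation mu := (dm R n).
Local Notation point := (n.-tuple (measurableTypeR R)).
Implicit Types (x y s : 'rV[R]_n) (d : R).

Lemma fejern_cvg1 x (d : nat -> R) : d k @[k --> \oo] --> 0 ->
  fejern (d k) x @[k --> \oo] --> (1 : R).
Proof.
move=> d0; rewrite /fejern; elim: (index_enum 'I_n) => [|i r IH].
  by under eq_fun do rewrite big_nil; exact: cvg_cst.
under eq_fun do rewrite big_cons.
have fi : fejer (d k) (x 0 i) @[k --> \oo] --> (1 : R) by exact: fejer_cvg1.
by apply: cvg_trans (cvgM fi IH) _; rewrite mulr1.
Qed.

Lemma tent_le d (s : R) : 0 < d -> tent d s <= d^-1.
Proof.
move=> d0; rewrite /tent ler_pdivrMr ?pmulrn_lgt0 ?exprn_gt0//.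
rewrite (_ : d^-1 * (d ^+ 2 *+ 2) = d *+ 2); last by field; rewrite gt_eqF.
have := ler_normD s d; have := ler_normB s d; rewrite (gtr0_norm d0); lra.
Qed.

Lemma tentn_le d s : 0 < d -> tentn d s <= d^-1 ^+ n.
Proof.
move=> d0; rewrite -[X in _ <= _ ^+ X]card_ord -prodr_const.
by apply: ler_prod => i _; rewrite tent_ge0 tent_le.
Qed.

Lemma l1_cisM x y (A : G2n) : l1 (cis x y * A) <= 2 ^+ n * l1 A.
Proof. by rewrite (le_trans (l1M _ _))// ler_wpM2r ?l1_ge0// l1_cis. Qed.

Lemma inv_cftE (f : 'rV[R]_n -> G2n) x :
  inv_cft f x = clint mu (fun t => cis x (X t) * f (X t)).
Proof. by congr clint; apply/funext => t; rewrite cexp_Iform. Qed.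

Variable f : 'rV[R]_n -> G2n.
Hypothesis fi : clintegrable mu (fun t => f (X t)).
Hypothesis gi : clintegrable mu (fun t => inv_cft f (X t)).

Let fil : clintegrable lam (fun t => f (X t)).
Proof. exact/clintegrable_dm. Qed.

Let rvX1 : rvmeas (fun z : point * point => X z.1).
Proof.
move=> i; apply: (@measurableT_comp _ _ _ _ _ _ (fun t => X t 0 i)) => //.
exact: rvmeas_point.
Qed.

Let rvX2 : rvmeas (fun z : point * point => X z.2).
Proof.
move=> i; apply: (@measurableT_comp _ _ _ _ _ _ (fun t => X t 0 i)) => //.
exact: rvmeas_point.
Qed.

(** Insert the definition of the inverse transform and exchange the integrals:
    by [cis x (- y) * cis x t = cis x (t - y)] the inner integral becomes the
    Fourier transform of the Fejer kernel at [t - y], a multiple of the tent.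
    The squared normalization of the measure cancels the factor [(2 pi) ^ n]. *)
Lemma inv_cft_fejer d y : 0 < d ->
  clint mu (fun t => fejern d (X t) *: (cis (X t) (- y) * inv_cft f (X t))) =
  clint lam (fun t => tentn d (X t - y) *: f (X t)).
Proof.
move=> d0; have dn0 : d != 0 by rewrite gt_eqF.
have fej : rintegrable lam (fun t => fejern d (X t)) by exact: rintegrable_fejern.
pose K (z : point * point) : G2n := fejern d (X z.1) *: (cis (X z.1) (X z.2 - y) * f (X z.2)).
pose B (t : point) := 2 ^+ n * l1 (f (X t)).
have Bi : rintegrable lam B by exact/rintegrableZ/clintegrable_l1.
have KB z : l1 (K z) <= fejern d (X z.1) * B z.2.
  by rewrite l1Z (ger0_norm (fejern_ge0 _ _)) ler_wpM2l ?fejern_ge0// l1_cisM.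
have mK : clmeas K.
  apply: clmeasZ; first exact: meas_fejern.
  apply: clmeasM.
    apply: clmeas_cis => // i; under eq_fun do rewrite !mxE.
    apply: measurable_funB; last exact: measurable_cst.
    by have := rvX2 i; under eq_fun do rewrite mxE.
  move=> I; apply: (@measurableT_comp _ _ _ _ _ _ (fun t => coef (f (X t)) I)) => //.
  exact: rintegrable_meas (fil I).
have Ki : clintegrable (lam \x lam)%E K.
  exact: (le_clintegrable mK KB (rintegrable_prodM fej Bi)).
have K1 t : clintegrable lam (fun a => K (a, t)).
  apply: (@le_clintegrable _ _ _ _ lam _ (fun a => B t * fejern d (X a))) => [I|a|].
  - by apply: (@measurableT_comp _ _ _ _ _ _ (fun z => coef (K z) I)) => //; exact: mK.
  - by rewrite mulrC; exact: (KB (a, t)).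
  - exact: rintegrableZ.
have K2 a : clintegrable lam (fun t => K (a, t)).
  apply: (le_clintegrable (g := fun t => fejern d (X a) * B t)) => [I|t|].
  - by apply: (@measurableT_comp _ _ _ _ _ _ (fun z => coef (K z) I)) => //; exact: mK.
  - exact: (KB (a, t)).
  - exact: rintegrableZ.
pose G t := fejern d (X t) *: (cis (X t) (- y) * inv_cft f (X t)).
have rvX : rvmeas X by exact: rvmeas_point.
have Gi : clintegrable mu G.
  apply: (le_clintegrable (g := fun t => 2 ^+ n * l1 (inv_cft f (X t)))) => [|t|].
  - apply: clmeasZ; first exact: meas_fejern rvX.
    apply: clmeasM; last exact: clintegrable_meas gi.
    by apply: clmeas_cis => //; exact: rvmeas_cst.
  - rewrite l1Z (ger0_norm (fejern_ge0 _ _)).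
    rewrite (le_trans (ler_wpM2l (fejern_ge0 _ _) (l1_cisM _ _ _)))//.
    by rewrite ler_piMl ?fejern_le1// mulr_ge0 ?l1_ge0.
  - exact/rintegrableZ/clintegrable_l1.
have c0 : @dm_const R n != 0 by rewrite gt_eqF// dm_const_gt0.
have Ii x : clintegrable lam (fun t => cis x (X t) * f (X t)).
  apply: (le_clintegrable (g := B)) => [|t|//]; last exact: l1_cisM.
  apply: clmeasM; last exact: clintegrable_meas fil.
  by apply: clmeas_cis => //; exact: rvmeas_cst.
have GK t : clint lam (fun a => K (t, a)) = (@dm_const R n)^-1 *: G t.
  rewrite /G inv_cftE clint_dm// -scalerAr !scalerA mulrAC mulVf// mul1r.
  rewrite scalerAl -clint_mull//.
  congr clint; apply/funext => a.
  by rewrite /K /= [X a - y]addrC cisD -mulrA scalerAl.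
have KT t : clint lam (fun a => K (a, t)) =
    ((2 * pi) ^+ n) *: (tentn d (X t - y) *: f (X t)).
  rewrite scalerA -mulr_algl -(fejern_fourier (X t - y) dn0) -clint_mulr.
    by congr clint; apply/funext => a; rewrite /K /= scalerAl.
  apply: (le_clintegrable (g := fun t => 2 ^+ n * fejern d (X t))) => [|a|].
  - apply: clmeasZ; first exact: meas_fejern rvX.
    by apply: clmeas_cis => //; exact: rvmeas_cst.
  - rewrite l1Z (ger0_norm (fejern_ge0 _ _)) mulrC.
    by rewrite ler_wpM2r ?fejern_ge0// l1_cis.
  - exact: rintegrableZ.
have Ti : clintegrable lam (fun t => tentn d (X t - y) *: f (X t)).
  apply: (le_clintegrable (g := fun t => d^-1 ^+ n * l1 (f (X t)))) => [|t|].
  - apply: clmeasZ; last exact: clintegrable_meas fil.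
    exact: rintegrable_meas (tentn_integral y d0).1.
  - rewrite l1Z (ger0_norm (tentn_ge0 _ _)).
    by rewrite ler_wpM2r ?l1_ge0// tentn_le.
  - exact/rintegrableZ/clintegrable_l1.
have Gil : clintegrable lam G by exact/clintegrable_dm.
have := clint_fubini Ki K2 K1.
rewrite (funext GK) (funext KT) !clint_scale// => FE.
rewrite clint_dm// -[clint lam G](scale1r) -(mulfV c0) -[_ *: clint lam G]scalerA FE.
by rewrite !scalerA -expr2 dm_const_sqr scale1r.
Qed.

(** At a point of continuity the regularized inversion formula passes to the
    limit on both sides. *)
Lemma F1_inv_cft y : {for y, continuous f} -> F1 (inv_cft f) (row_mx y 0) = f y.
Proof.
move=> cf; pose d (k : nat) : R := k.+1%:R^-1.
have d0 k : 0 < d k by rewrite invr_gt0.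
have dk0 : d k @[k --> \oo] --> 0 by exact: cvg_harmonic.
have rvX : rvmeas X by exact: rvmeas_point.
have := tentn_approx cf (clintegrable_meas fi) d0 dk0.
under eq_fun do rewrite -inv_cft_fejer//.
move=> lim_f.
have lim_F1 : clint mu (fun t => fejern (d k) (X t) *: (cis (X t) (- y) * inv_cft f (X t)))
    @[k --> \oo] --> F1 (inv_cft f) (row_mx y 0).
  have -> : F1 (inv_cft f) (row_mx y 0) =
      clint mu (fun t => cis (X t) (- y) * inv_cft f (X t)).
    congr clint; apply/funext => t; rewrite cexp_Iform_ext row_mxKl row_mxKr.
    by rewrite /dotp big1 ?expR0 ?scale1r// => i _; rewrite !mxE mulr0.
  apply: (clint_cvg (g := fun t => 2 ^+ n * l1 (inv_cft f (X t)))) => [k|t|k t|].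
  - apply: clmeasZ; first exact: meas_fejern rvX.
    apply: clmeasM; last exact: clintegrable_meas gi.
    by apply: clmeas_cis => //; exact: rvmeas_cst.
  - apply: cvg_trans (cvgZr_tmp (fejern_cvg1 (X t) dk0)) _.
    by rewrite scale1r.
  - rewrite l1Z (ger0_norm (fejern_ge0 _ _)).
    rewrite (le_trans (ler_wpM2l (fejern_ge0 _ _) (l1_cisM _ _ _)))//.
    by rewrite ler_piMl ?fejern_le1// mulr_ge0 ?l1_ge0.
  - exact/rintegrableZ/clintegrable_l1.
exact: (cvg_unique _ lim_F1 lim_f).
Qed.

End InversionTheorem.

(** * The monogenic extension *)

Unset Implicit Arguments.

Theorem theorem4p1 (R : realType) (n : nat)
    (f : 'rV[R]_n -> clifford R (n + n)) :
  continuous f ->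
  cintegrable f ->
  cintegrable (inv_cft f) ->
  (forall yy : 'rV[R]_(n + n),
     cintegrable (fun x => expR (dotp x (rsubmx yy)) *: inv_cft f x) /\
     forall i : 'I_n,
       cintegrable (fun x =>
         (x 0 i * expR (dotp x (rsubmx yy))) *: inv_cft f x)) ->
  [/\ forall yy : 'rV[R]_(n + n),
        cintegrable (fun x => cexp (- Iform_ext x yy) * inv_cft f x),
      monogenic setT (F1 (inv_cft f)) &
      forall y : 'rV[R]_n, F1 (inv_cft f) (row_mx y 0) = f y].
Proof.
move=> cf /cintegrableP fi /cintegrableP gi gexp.
have g_exp z : clintegrable (dm R n) (fun t =>
    expR (dotp (rV_of_tuple t) z) *: inv_cft f (rV_of_tuple t)).
  by have [/cintegrableP + _] := gexp (row_mx 0 z); rewrite row_mxKr.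
have g_mexp z i : clintegrable (dm R n) (fun t =>
    (rV_of_tuple t 0 i * expR (dotp (rV_of_tuple t) z)) *: inv_cft f (rV_of_tuple t)).
  by have [_ /(_ i)/cintegrableP] := gexp (row_mx 0 z); rewrite row_mxKr.
have mg := clintegrable_meas gi.
split=> [yy||y].
- by apply/cintegrableP; exact: (clintegrable_kernelM mg g_exp yy).
- exact: (F1_monogenic mg g_exp g_mexp).
- exact: (F1_inv_cft fi gi (cf y)).
Qed.
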